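(* Let $\varphi:\mathbb{R}^n\to\overline{\mathbb{R}}$ be continuously prox-regular at $\bar x\in\operatorname{dom}\varphi$ for $0\in\partial\varphi(\bar x)$, and let $\kappa>0$. Then the following assertions are equivalent: (i) $\bar x$ is a tilt-stable local minimizer of $\varphi$ with modulus $\kappa$. (ii) There exist neighborhoods $U$ of $\bar x$ and $V$ of the origin in $\mathbb{R}^n$ such that $$\langle z,w\rangle\ge\frac1\kappa\|w\|^2\quad\text{whenever } z\in\breve\partial^2\varphi(x,y)(w),\ (x,y)\in\operatorname{gph}\partial\varphi\cap(U\times V),\ w\in\mathbb{R}^n.$$ (iii) There exist neighborhoods $U$ of $\bar x$ and $V$ of the origin in $\mathbb{R}^n$ such that $$\langle z,w\rangle\ge\frac1\kappa\|w\|^2\quad\text{whenever } z\in\partial^2\varphi(x,y)(w),\ (x,y)\in\operatorname{gph}\partial\varphi\cap(U\times V),\ w\in\mathbb{R}^n.$$ Furthermore, the fulfillment of (i) with some modulus $\kappa>0$ is equivalent to the pointbased positive-definiteness condition $$\langle z,w\rangle>0\quad\text{whenever } z\in\partial^2\varphi(\bar x,0)(w),\ w\ne0.$$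
   Context: Conventions: $\overline{\mathbb{R}}:=(-\infty,\infty]$; every extended-real-valued function is assumed proper, i.e. $\operatorname{dom}\varphi:=\{x\mid\varphi(x)<\infty\}\neq\emptyset$. $\mathbb{B}_\epsilon(a)$ is the closed ball with center $a$ and radius $\epsilon$; l.s.c. means lower semicontinuous. Subdifferentials: for $\bar x\in\operatorname{dom}\varphi$, $$\widehat\partial\varphi(\bar x)=\Big\{v\in\mathbb{R}^n\;\Big|\;\liminf_{x\to\bar x}\frac{\varphi(x)-\varphi(\bar x)-\langle v,x-\bar x\rangle}{\|x-\bar x\|}\ge 0\Big\},$$ and the limiting subdifferential $\partial\varphi(\bar x)$ is the set of all $v$ for which there are $x_k\to\bar x$ with $\varphi(x_k)\to\varphi(\bar x)$ and $v_k\in\widehat\partial\varphi(x_k)$ with $v_k\to v$. For a set $\Omega$ with indicator function $\delta_\Omega$ the regular and limiting normal cones at $\bar x\in\Omega$ are $\widehat N_\Omega(\bar x):=\widehat\partial\delta_\Omega(\bar x)$ and $N_\Omega(\bar x):=\partial\delta_\Omega(\bar x)$. Second-order subdifferentials: for $(x,y)\in\operatorname{gph}\partial\varphi$ and $w\in\mathbb{R}^n$, the combined and the limiting second-order subdifferentials are $$\breve\partial^2\varphi(x,y)(w):=\{z\mid(z,-w)\in\widehat N_{\operatorname{gph}\partial\varphi}(x,y)\},\qquad \partial^2\varphi(x,y)(w):=\{z\mid(z,-w)\in N_{\operatorname{gph}\partial\varphi}(x,y)\}.$$ Continuous prox-regularity at $\bar x$ for $\bar v$ means that $\varphi$ is both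 prox-regular and subdifferentially continuous at $\bar x$ for $\bar v$. An l.s.c. function $\varphi$ is prox-regular at $\bar x$ for $\bar v\in\partial\varphi(\bar x)$ if there exist $\epsilon>0$ and $r\ge0$ such that $\varphi(x)\ge\varphi(u)+\langle v,x-u\rangle-\frac r2\|x-u\|^2$ for all $x\in\mathbb{B}_\epsilon(\bar x)$ and all $(u,v)\in\operatorname{gph}\partial\varphi\cap(\mathbb{B}_\epsilon(\bar x)\times\mathbb{B}_\epsilon(\bar v))$ with $\varphi(u)<\varphi(\bar x)+\epsilon$. It is subdifferentially continuous at $\bar x$ for $\bar v$ if for every $\epsilon>0$ there is $\delta>0$ such that $|\varphi(x)-\varphi(\bar x)|<\epsilon$ whenever $(x,v)\in\operatorname{gph}\partial\varphi\cap(\mathbb{B}_\delta(\bar x)\times\mathbb{B}_\delta(\bar v))$. Tilt stability: $\bar x\in\operatorname{dom}\varphi$ is a tilt-stable local minimizer of $\varphi$ with modulus $\kappa>0$ if there exists $\gamma>0$ such that the mapping $M_\gamma:v\mapsto\operatorname{argmin}\{\varphi(x)-\langle v,x\rangle\mid x\in\mathbb{B}_\gamma(\bar x)\}$ is single-valued and Lipschitz continuous with constant $\kappa$ on some neighborhood of $0\in\mathbb{R}^n$, with $M_\gamma(0)=\{\bar x\}$. *)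

(* Defs.v *)
From HB Require Import structures.
From mathcomp Require Import all_boot all_order all_algebra.
From mathcomp Require Import all_classical all_reals all_analysis.
Set Implicit Arguments.
Unset Strict Implicit.
Unset Printing Implicit Defensive.

Import Order.TTheory GRing.Theory Num.Theory.
Import numFieldNormedType.Exports.

Local Open Scope classical_set_scope.
Local Open Scope ring_scope.

(* R^n is ['rV[R]_n].  The library norm [`|x|] on row vectors is the max norm,
   so the Euclidean norm is defined here; the two induce the same topology, and
   [nbhs] and limits below are the library's. *)

Definition dot (R : realType) n (x y : 'rV[R]_n) : R :=
  \sum_(i < n) x 0 i * y 0 i.

Definition enorm (R : realType) n (x : 'rV[R]_n) : R := Num.sqrt (dot x x).

Definition eball (R : realType) n (a : 'rV[R]_n) (e : R) : set 'rV[R]_n :=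
  [set x | enorm (x - a) <= e].

Definition dom (R : realType) n (phi : 'rV[R]_n -> \bar R) : set 'rV[R]_n :=
  [set x | (phi x < +oo)%E].

(* Functions into (-oo, +oo] are functions into [\bar R] avoiding [-oo]. *)
Definition proper_fun (R : realType) n (phi : 'rV[R]_n -> \bar R) : Prop :=
  (forall x, phi x != -oo%E) /\ dom phi !=set0.

(* [xbar^'] is the punctured neighborhood filter: the quotient is not defined
   at [xbar].  Subdifferentials are empty outside the domain. *)
Definition regular_subdiff (R : realType) n (phi : 'rV[R]_n -> \bar R)
    (xbar : 'rV[R]_n) : set 'rV[R]_n :=
  [set v | dom phi xbar /\
    (0 <= limf_einf
            (fun x => (phi x - phi xbar - (dot v (x - xbar))%:E)
                      * ((enorm (x - xbar))^-1)%:E)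
            xbar^')%E].

Definition limiting_subdiff (R : realType) n (phi : 'rV[R]_n -> \bar R)
    (xbar : 'rV[R]_n) : set 'rV[R]_n :=
  [set v | dom phi xbar /\
    exists (x_ v_ : nat -> 'rV[R]_n),
      [/\ x_ @ \oo --> xbar,
          (phi \o x_) @ \oo --> phi xbar,
          forall k, regular_subdiff phi (x_ k) (v_ k) &
          v_ @ \oo --> v]].

Definition indicator (R : realType) n (A : set 'rV[R]_n) (x : 'rV[R]_n)
    : \bar R :=
  if `[< A x >] then 0%E else +oo%E.

Definition regular_normal_cone (R : realType) n (A : set 'rV[R]_n)
    (x : 'rV[R]_n) : set 'rV[R]_n :=
  regular_subdiff (indicator A) x.

Definition limiting_normal_cone (R : realType) n (A : set 'rV[R]_n)
    (x : 'rV[R]_n) : set 'rV[R]_n :=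
  limiting_subdiff (indicator A) x.

(* R^n x R^n is R^(n+n), with its Euclidean structure; the pair (x, y) is
   [row_mx x y]. *)
Definition gph (R : realType) n (F : 'rV[R]_n -> set 'rV[R]_n)
    : set 'rV[R]_(n + n) :=
  [set row_mx p.1 p.2 | p in [set p : 'rV[R]_n * 'rV[R]_n | F p.1 p.2]].

Definition combined_subdiff2 (R : realType) n (phi : 'rV[R]_n -> \bar R)
    (x y w : 'rV[R]_n) : set 'rV[R]_n :=
  [set z | regular_normal_cone (gph (limiting_subdiff phi))
             (row_mx x y) (row_mx z (- w))].

Definition limiting_subdiff2 (R : realType) n (phi : 'rV[R]_n -> \bar R)
    (x y w : 'rV[R]_n) : set 'rV[R]_n :=
  [set z | limiting_normal_cone (gph (limiting_subdiff phi))
             (row_mx x y) (row_mx z (- w))].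

Definition prox_regular (R : realType) n (phi : 'rV[R]_n -> \bar R)
    (xbar vbar : 'rV[R]_n) : Prop :=
  [/\ lower_semicontinuous phi,
      limiting_subdiff phi xbar vbar &
      exists eps r : R, [/\ 0 < eps, 0 <= r &
        forall x u v : 'rV[R]_n,
          eball xbar eps x ->
          limiting_subdiff phi u v -> eball xbar eps u -> eball vbar eps v ->
          (phi u < phi xbar + eps%:E)%E ->
          (phi u + (dot v (x - u))%:E - (r / 2 * enorm (x - u) ^+ 2)%:E
           <= phi x)%E]].

Definition subdiff_continuous (R : realType) n (phi : 'rV[R]_n -> \bar R)
    (xbar vbar : 'rV[R]_n) : Prop :=
  forall eps : R, 0 < eps -> exists2 delta : R, 0 < delta &
    forall x v : 'rV[R]_n,
      limiting_subdiff phi x v -> eball xbar delta x -> eball vbar delta v ->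
      (`|phi x - phi xbar| < eps%:E)%E.

Definition continuously_prox_regular (R : realType) n
    (phi : 'rV[R]_n -> \bar R) (xbar vbar : 'rV[R]_n) : Prop :=
  prox_regular phi xbar vbar /\ subdiff_continuous phi xbar vbar.

Definition argmin (R : realType) n (f : 'rV[R]_n -> \bar R)
    (A : set 'rV[R]_n) : set 'rV[R]_n :=
  [set x | A x /\ forall u, A u -> (f x <= f u)%E].

Definition tilt_argmin (R : realType) n (phi : 'rV[R]_n -> \bar R)
    (xbar : 'rV[R]_n) (gamma : R) (v : 'rV[R]_n) : set 'rV[R]_n :=
  argmin (fun x => phi x - (dot v x)%:E)%E (eball xbar gamma).

(* [m] is the single-valued selection of the mapping on the neighborhood [V];
   its values outside [V] are irrelevant. *)
Definition tilt_stable (R : realType) n (phi : 'rV[R]_n -> \bar R)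
    (xbar : 'rV[R]_n) (kappa : R) : Prop :=
  [/\ dom phi xbar, 0 < kappa &
      exists2 gamma : R, 0 < gamma &
        tilt_argmin phi xbar gamma 0 = [set xbar] /\
        exists (V : set 'rV[R]_n) (m : 'rV[R]_n -> 'rV[R]_n),
          [/\ nbhs (0 : 'rV[R]_n) V,
              forall v, V v -> tilt_argmin phi xbar gamma v = [set m v] &
              forall v1 v2, V v1 -> V v2 ->
                enorm (m v1 - m v2) <= kappa * enorm (v1 - v2)]].

(* Main.v *)
(* Let [lam = r + 1] with [r] the prox-regularity constant. Near (xbar, 0) the
   graph of the subdifferential is parametrized by the 1-Lipschitz resolvent
   [P u = argmin (phi + lam/2 |. - xbar|^2 - <u, .>)] through
   [u |-> (P u, u - lam (P u - xbar))], and [s] is a regular subgradient of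
   [<q, P>] at [u] exactly when [(lam s - q, s)] is a regular normal to the
   graph. (ii) thus says that subgradients of [<q, P>], |q| = 1, are bounded by
   [l = 1 / (lam + 1/kappa)]. A mean value inequality, proved by penalization
   and so without Rademacher's theorem, makes [P] l-Lipschitz; by conjugate
   duality [phi] has quadratic growth at xbar, and the fixed point equation
   [x = P (v + lam (x - xbar))] of tilted minimizers yields (i).
   Conversely the tilted argmin map [m] is the gradient of a convex function,
   hence 1/kappa-cocoercive (Baillon-Haddad), and its graph exhausts the graph
   of the subdifferential near (xbar, 0). Testing a normal [(z, -w)] along
   [y + t (z - (2/kappa) w)] gives (ii), and (iii) follows by closure.
   For the pointbased criterion, if no [l < 1/lam] bounds the subgradients
   near 0, a limit of unit [q] and subgradients [s] with liminf |s| >= 1/lam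
   violates positive definiteness. *)
Require Import Defs.
From mathcomp Require Import all_boot all_order all_algebra.
From mathcomp Require Import all_classical all_reals all_analysis.
From mathcomp Require Import ring lra.
Import Order.TTheory GRing.Theory Num.Theory.
Import numFieldNormedType.Exports.
Local Open Scope classical_set_scope.
Local Open Scope ring_scope.

(** * Euclidean geometry and topology of row vectors *)

Lemma dotC {R : realType} {n} (x y : 'rV[R]_n) : dot x y = dot y x.
Proof. by apply: eq_bigr => i _; rewrite mulrC. Qed.

Lemma dotDl {R : realType} {n} (x y z : 'rV[R]_n) :
  dot (x + y) z = dot x z + dot y z.
Proof. by rewrite -big_split; apply: eq_bigr => i _; rewrite mxE mulrDl. Qed.

Lemma dotZl {R : realType} {n} a (x y : 'rV[R]_n) :
  dot (a *: x) y = a * dot x y.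
Proof. by rewrite /dot mulr_sumr; apply: eq_bigr => i _; rewrite mxE mulrA. Qed.

Lemma dotDr {R : realType} {n} (x y z : 'rV[R]_n) :
  dot x (y + z) = dot x y + dot x z.
Proof. by rewrite dotC dotDl !(dotC x). Qed.

Lemma dotZr {R : realType} {n} a (x y : 'rV[R]_n) :
  dot x (a *: y) = a * dot x y.
Proof. by rewrite dotC dotZl dotC. Qed.

Lemma dotNl {R : realType} {n} (x y : 'rV[R]_n) : dot (- x) y = - dot x y.
Proof. by rewrite -scaleN1r dotZl mulN1r. Qed.

Lemma dotNr {R : realType} {n} (x y : 'rV[R]_n) : dot x (- y) = - dot x y.
Proof. by rewrite dotC dotNl dotC. Qed.

Lemma dot0l {R : realType} {n} (x : 'rV[R]_n) : dot 0 x = 0.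
Proof. by rewrite -(scale0r x) dotZl mul0r. Qed.

Lemma dot0r {R : realType} {n} (x : 'rV[R]_n) : dot x 0 = 0.
Proof. by rewrite dotC dot0l. Qed.

Definition dotE := (@dotDl, @dotDr, @dotNl, @dotNr, @dotZl, @dotZr, @dot0l,
  @dot0r).

Lemma dot_row_mx {R : realType} {n} (a b c d : 'rV[R]_n) :
  dot (row_mx a b) (row_mx c d) = dot a c + dot b d.
Proof.
rewrite /dot big_split_ord /=; congr (_ + _); apply: eq_bigr => i _.
  by rewrite !row_mxEl.
by rewrite !row_mxEr.
Qed.

Lemma dotxx_ge0 {R : realType} {n} (x : 'rV[R]_n) : 0 <= dot x x.
Proof. by apply: sumr_ge0 => i _; rewrite -expr2 sqr_ge0. Qed.

Lemma enorm_ge0 {R : realType} {n} (x : 'rV[R]_n) : 0 <= enorm x.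
Proof. exact: sqrtr_ge0. Qed.

Lemma enorm_sqr {R : realType} {n} (x : 'rV[R]_n) : enorm x ^+ 2 = dot x x.
Proof. by rewrite sqr_sqrtr // dotxx_ge0. Qed.

Lemma enorm0 {R : realType} {n} : enorm (0 : 'rV[R]_n) = 0.
Proof. by rewrite /enorm dot0l sqrtr0. Qed.

Lemma enormN {R : realType} {n} (x : 'rV[R]_n) : enorm (- x) = enorm x.
Proof. by rewrite /enorm dotNl dotNr opprK. Qed.

Lemma enormB {R : realType} {n} (x y : 'rV[R]_n) :
  enorm (x - y) = enorm (y - x).
Proof. by rewrite -enormN opprB. Qed.

Lemma enormZ {R : realType} {n} a (x : 'rV[R]_n) :
  enorm (a *: x) = `|a| * enorm x.
Proof.
by rewrite /enorm dotZl dotZr mulrA -expr2 sqrtrM ?sqr_ge0 // sqrtr_sqr.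
Qed.

Lemma coord_le_enorm {R : realType} {n} (x : 'rV[R]_n) i : `|x 0 i| <= enorm x.
Proof.
rewrite -sqrtr_sqr ler_wsqrtr // /dot (bigD1 i) //= expr2 lerDl.
by apply: sumr_ge0 => j _; rewrite -expr2 sqr_ge0.
Qed.

Lemma enorm_eq0 {R : realType} {n} (x : 'rV[R]_n) : (enorm x == 0) = (x == 0).
Proof.
apply/eqP/eqP => [x0|->]; last exact: enorm0.
apply/rowP => i; rewrite mxE; apply/eqP; rewrite -normr_le0 -x0.
exact: coord_le_enorm.
Qed.

Lemma enorm_gt0 {R : realType} {n} (x : 'rV[R]_n) : (0 < enorm x) = (x != 0).
Proof. by rewrite lt0r enorm_ge0 andbT enorm_eq0. Qed.

(** For nonzero vectors, expanding the squared norm of [|y| x - |x| y] gives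
    [2 |x| |y| (|x| |y| - <x, y>) >= 0], and the positive factor cancels. *)
Lemma cauchy_schwarz {R : realType} {n} (x y : 'rV[R]_n) :
  dot x y <= enorm x * enorm y.
Proof.
have [->|x0] := eqVneq x 0; first by rewrite dot0l enorm0 mul0r.
have [->|y0] := eqVneq y 0; first by rewrite dot0r enorm0 mulr0.
rewrite -enorm_gt0 in x0; rewrite -enorm_gt0 in y0.
have xy0 := mulr_gt0 x0 y0.
have := dotxx_ge0 (enorm y *: x - enorm x *: y).
rewrite !dotE (dotC y x) -!enorm_sqr -subr_ge0 => h.
rewrite -subr_ge0 -(pmulr_rge0 _ xy0); nra.
Qed.

Lemma enormD {R : realType} {n} (x y : 'rV[R]_n) :
  enorm (x + y) <= enorm x + enorm y.
Proof.
have := cauchy_schwarz x y; have := enorm_ge0 x; have := enorm_ge0 y.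
move=> y0 x0 cs; rewrite -(@ler_pXn2r _ 2) ?nnegrE ?enorm_ge0 ?addr_ge0 //.
rewrite enorm_sqr !dotE (dotC y x) -!enorm_sqr; nra.
Qed.

Lemma enorm_dist {R : realType} {n} (y x z : 'rV[R]_n) :
  enorm (x - z) <= enorm (x - y) + enorm (y - z).
Proof. by rewrite -{1}(subrKA y) enormD. Qed.

(** Used after Cauchy-Schwarz to cancel one factor [|x|] without splitting off [x = 0] each time. *)
Lemma le_enormP {R : realType} {n} (x : 'rV[R]_n) c :
  0 <= c -> dot x x <= c * enorm x -> enorm x <= c.
Proof.
move=> c0; rewrite -enorm_sqr; have [->//|x0] := eqVneq (enorm x) 0.
have {}x0 : 0 < enorm x by rewrite lt0r x0 enorm_ge0.
by rewrite expr2 ler_pM2r.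
Qed.

Lemma enorm_row_mx_ge {R : realType} {n} (a b : 'rV[R]_n) :
  enorm a <= enorm (row_mx a b) /\ enorm b <= enorm (row_mx a b).
Proof.
by split; apply: ler_wsqrtr; rewrite dot_row_mx ?lerDl ?lerDr dotxx_ge0.
Qed.

Lemma enorm_row_mx_le {R : realType} {n} (a b : 'rV[R]_n) :
  enorm (row_mx a b) <= enorm a + enorm b.
Proof.
rewrite -(@ler_pXn2r _ 2) ?nnegrE ?enorm_ge0 ?addr_ge0 ?enorm_ge0 //.
rewrite enorm_sqr dot_row_mx -!enorm_sqr.
by have := enorm_ge0 a; have := enorm_ge0 b; nra.
Qed.

Lemma row_mxB {R : realType} {n} (a b c d : 'rV[R]_n) :
  row_mx a b - row_mx c d = row_mx (a - c) (b - d).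
Proof. by rewrite opp_row_mx add_row_mx. Qed.

Lemma norm_le_enorm {R : realType} {n} (x : 'rV[R]_n) : `|x| <= enorm x.
Proof.
rewrite [leLHS]/Num.norm /= mx_normrE bigmax_le ?enorm_ge0 // => -[i j] _ /=.
by rewrite (ord1 i) coord_le_enorm.
Qed.

Lemma enorm_le_norm {R : realType} {n} (x : 'rV[R]_n) :
  enorm x <= n%:R * `|x|.
Proof.
have hx i : `|x 0 i| <= `|x|.
  rewrite [leRHS]/Num.norm /= mx_normrE.
  exact: (le_bigmax _ (fun i : 'I_1 * 'I_n => `|x i.1 i.2|) (0, i)).
have -> : enorm x = enorm (\sum_(i < n) x 0 i *: (delta_mx 0 i : 'rV[R]_n)).
  by rewrite -row_sum_delta.
have h (I : finType) (f : I -> 'rV[R]_n) :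
    enorm (\sum_i f i) <= \sum_i enorm (f i).
  elim/big_ind2: _ => // [|a b c d ab cd]; first by rewrite enorm0.
  exact: le_trans (enormD _ _) (lerD ab cd).
apply: le_trans (h _ _) _.
have -> : n%:R * `|x| = \sum_(i < n) `|x|.
  by rewrite sumr_const card_ord mulr_natl.
apply: ler_sum => i _.
rewrite enormZ /enorm /dot (bigD1 i) //= !mxE !eqxx big1 => [|j ji].
  by rewrite addr0 mulr1 sqrtr1 mulr1.
by rewrite !mxE eqxx (negPf ji) mulr0.
Qed.

Lemma nbhs_enormP {R : realType} {n} (x : 'rV[R]_n) (U : set 'rV[R]_n) :
  nbhs x U <-> exists2 d : R, 0 < d & forall y, enorm (y - x) < d -> U y.
Proof.
split=> [/nbhs_ballP[e /= e0 xU]|[d d0 dU]].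
  exists e => // y yx; apply: xU; rewrite -ball_normE /= distrC.
  exact: le_lt_trans (norm_le_enorm _) yx.
(* The successor keeps the divisor positive in dimension zero. *)
have n0 : 0 < (n.+1%:R : R) by rewrite ltr0n.
apply/nbhs_ballP; exists (d / n.+1%:R) => /=; first exact: divr_gt0.
move=> y; rewrite -ball_normE /= distrC ltr_pdivlMr // => yx.
apply: dU; apply: le_lt_trans (enorm_le_norm _) _.
by apply: le_lt_trans yx; rewrite mulrC ler_wpM2l // ler_nat.
Qed.

Lemma cvg_enormP {R : realType} {n} (x_ : nat -> 'rV[R]_n) (x : 'rV[R]_n) :
  x_ @ \oo --> x <->
  forall e : R, 0 < e -> \forall k \near \oo, enorm (x_ k - x) < e.
Proof.
split=> [cx e e0|h U /nbhs_enormP[d d0 dU]].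
  by apply: (cx [set y | enorm (y - x) < e]); apply/nbhs_enormP; exists e.
by apply: filterS (h _ d0) => k; apply: dU.
Qed.

Lemma closed_eball {R : realType} {n} (a : 'rV[R]_n) r : closed (eball a r).
Proof.
rewrite -[eball a r]setCK; apply: open_closedC; rewrite openE => x.
rewrite /eball /= => /negP; rewrite -ltNge => xr.
apply/nbhs_enormP; exists (enorm (x - a) - r); first by rewrite subr_gt0.
move=> y yx; apply/negP; rewrite -ltNge.
by have := enorm_dist y x a; rewrite (enormB x y); lra.
Qed.

Lemma compact_eball {R : realType} {n} (a : 'rV[R]_n) r : compact (eball a r).
Proof.
apply: bounded_closed_compact; last exact: closed_eball.
exists (enorm a + r); split; first exact: num_real.
move=> M rM x xr; apply: (le_trans (norm_le_enorm _)); apply: ltW.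
apply: le_lt_trans rM; rewrite -{1}(subrK a x) addrC.
by apply: le_trans (enormD _ _) _; rewrite lerD2l.
Qed.

(** Over [N] equal pieces of the unit interval the increments add up to at most [C / N], which falls
    below any positive gap. This replaces differentiation along segments. *)
Lemma quadratic_increments {R : realType} (F : R -> R) C :
  (forall s t, 0 <= s -> s <= t -> t <= 1 -> F t - F s <= C * (t - s) ^+ 2) ->
  F 1 <= F 0.
Proof.
move=> hF; rewrite leNgt; apply/negP => F01.
have C0 : 0 < C.
  by have := hF 0 1 (lexx _) ler01 (lexx _); rewrite subr0 expr1n mulr1; lra.
set e := F 1 - F 0; have e0 : 0 < e by rewrite subr_gt0.
set N := Num.bound (C / e).
have hN : C / e < N%:R by apply: archi_boundP; apply: divr_ge0; exact: ltW.
have N0 : 0 < (N%:R : R) by apply: lt_trans hN; exact: divr_gt0.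
have step (k : nat) : (k <= N)%N ->
    F (k%:R / N%:R) - F 0 <= k%:R * (C / N%:R ^+ 2).
  elim: k => [|k ih] kN; first by rewrite !mul0r subrr.
  have {}ih := ih (ltnW kN).
  have := hF (k%:R / N%:R) (k.+1%:R / N%:R).
  rewrite -mulrBl -natr1 addrAC subrr add0r div1r.
  move=> /(_ (divr_ge0 (ler0n _ _) (ltW N0))).
  rewrite ler_pM2r ?invr_gt0 // lerDl ler01 => /(_ isT).
  rewrite ler_pdivrMr // mul1r natr1 ler_nat => /(_ kN).
  rewrite -natr1 mulrDl mul1r exprVn; lra.
have := step N (leqnn N); rewrite divff ?gt_eqF // -/e => h.
move: hN; rewrite ltr_pdivrMr // => hN.
have : e <= C / N%:R.
  suff <- : N%:R * (C / N%:R ^+ 2) = C / N%:R by [].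
  by field; rewrite gt_eqF.
by rewrite ler_pdivlMr // mulrC; lra.
Qed.

(** Compactness of a ball, applied to the filter generated by the decreasing sets. They need not be
    closed, so [p] is only approached from each of them. *)
Lemma nested_cluster {R : realType} {n} (S : nat -> set 'rV[R]_n) r :
  (forall k, S k !=set0) -> (forall k l, (k <= l)%N -> S l `<=` S k) ->
  (forall x, S 0%N x -> enorm x <= r) ->
  exists p, forall k e, 0 < e -> exists2 x, S k x & enorm (x - p) < e.
Proof.
move=> S0 Sdec Sr.
pose G := filter_from [set: nat] S.
have FG : Filter G.
  apply: filter_from_filter; first by exists 0%N.
  move=> i j _ _; exists (maxn i j) => // x Sx.
  by split; apply: Sdec Sx; rewrite ?leq_maxl ?leq_maxr.
have PG : ProperFilter G by exact: filter_from_proper.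
have GK : G (eball 0 r).
  by exists 0%N => // x /Sr; rewrite /eball /= subr0.
have [p [_ pG]] := @compact_eball _ _ 0 r G PG GK.
exists p => k e e0.
have Gk : G (S k) by exists k.
have pe : nbhs p [set x | enorm (x - p) < e] by apply/nbhs_enormP; exists e.
by have [x [Skx xe]] := pG _ _ Gk pe; exists x.
Qed.

(** Weierstrass for an extended-valued function: the sublevel sets of [phi + h] generate a filter on
    a compact ball, and lower semicontinuity makes its cluster point a minimizer. *)
Lemma min_eball {R : realType} {n} (phi : 'rV[R]_n -> \bar R)
    (h : 'rV[R]_n -> R) a r K :
  lower_semicontinuous phi -> (forall x, phi x != -oo%E) ->
  (exists2 x, eball a r x & dom phi x) -> 0 <= K ->
  (forall x y, eball a r x -> eball a r y -> h x - h y <= K * enorm (x - y)) ->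
  exists x, [/\ eball a r x, dom phi x & forall y, eball a r y -> dom phi y ->
    fine (phi x) + h x <= fine (phi y) + h y].
Proof.
move=> lsc noo [x0 ax0 dx0] K0 hK.
pose D := [set x | eball a r x /\ dom phi x].
pose g x := fine (phi x) + h x.
pose S y := [set x | D x /\ g x <= g y].
pose G := filter_from D S.
have FG : Filter G.
  apply: filter_from_filter; first by exists x0.
  move=> i j Di Dj; have [ij|ji] := leP (g i) (g j).
    by exists i => // x [Dx xi]; split; split=> //; exact: le_trans ij.
  by exists j => // x [Dx xj]; split; split=> //; exact: le_trans (ltW ji).
have PG : ProperFilter G by apply: filter_from_proper => y Dy; exists y.
have GK : G (eball a r) by exists x0 => // x [[]].
have [p [ap pG]] := @compact_eball _ _ a r G PG GK.
(* Otherwise the sublevel set of [y] contains a point near [p] where [phi] exceeds [c] and [h]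
   differs from [h p] by less than the gap [eta]. Working with reals [c] below [phi p] covers the
   case [phi p = +oo]. *)
have key y c : D y -> (c%:E < phi p)%E -> c + h p <= g y.
  move=> Dy cp; rewrite leNgt; apply/negP => gy.
  have [V /nbhs_enormP[d0 d00 dV] Vc] := lsc _ _ cp.
  pose eta := c + h p - g y; have eta0 : 0 < eta by rewrite subr_gt0.
  have K1 : 0 < K + 1 by rewrite ltr_wpDl.
  pose d := Num.min d0 (eta / (K + 1)).
  have dp : 0 < d by rewrite lt_min d00 divr_gt0.
  have pd : nbhs p [set x | enorm (x - p) < d] by apply/nbhs_enormP; exists d.
  have GS : G (S y) by exists y.
  have [x [[[ax dx] xy] /= xd]] := pG _ _ GS pd.
  move: xd; rewrite lt_min => /andP[xd0]; rewrite ltr_pdivlMr // => xK.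
  have := Vc _ (dV _ xd0).
  have xf : phi x \is a fin_num by rewrite fin_numE noo lt_eqF.
  rewrite -(fineK xf) lte_fin => cx.
  have := hK _ _ ap ax; rewrite enormB => hpx.
  have := enorm_ge0 (x - p).
  rewrite /g /= in xy; rewrite /eta /g in xK; nra.
have dp : dom phi p.
  rewrite /dom /= ltey; apply/eqP => pE.
  have := key x0 (g x0 - h p + 1) (conj ax0 dx0).
  by rewrite pE ltry => /(_ isT); lra.
exists p; split=> // y ay dy; rewrite -/(g y) -/(g p) leNgt; apply/negP => yp.
have pf : phi p \is a fin_num by rewrite fin_numE noo lt_eqF.
(* A level half the gap below [phi p] still contradicts [g y < g p]. *)
have := key y (fine (phi p) - (g p - g y) / 2) (conj ay dy).
rewrite -{2}(fineK pf) lte_fin gtrBl divr_gt0 ?subr_gt0 // => /(_ isT).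
have : g p = fine (phi p) + h p by [].
move: yp; set u := g y; set w := g p; lra.
Qed.

(** * Subdifferentials and normal cones in epsilon-delta form *)

Lemma regular_subdiffP {R : realType} {n} (phi : 'rV[R]_n -> \bar R) x v :
  (forall y, phi y != -oo%E) ->
  regular_subdiff phi x v <-> dom phi x /\
  forall e : R, 0 < e -> exists2 d : R, 0 < d & forall y, dom phi y ->
    enorm (y - x) < d ->
    fine (phi x) + dot v (y - x) - e * enorm (y - x) <= fine (phi y).
Proof.
move=> noo; rewrite /regular_subdiff /= limf_einfE.
have fin y : dom phi y -> phi y \is a fin_num.
  by move=> dy; rewrite fin_numE noo lt_eqF.
split=> [[dx h]|[dx h]]; split=> //.
  move=> e e0.
  (* The liminf is a supremum of infima, so some punctured neighborhood [A] has infimum above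
     [- e]. *)
  have /ereal_sup_gt[_ [A xA <-] Ae] : ((- e)%:E < ereal_sup
    [set ereal_inf ((fun y => (phi y - phi x - (dot v (y - x))%:E) *
       (enorm (y - x))^-1%:E) @` V) | V in x^'])%E.
    by apply: lt_le_trans h; rewrite lte_fin oppr_lt0.
  have /nbhs_enormP[d d0 dA] : nbhs x [set y | y != x -> A y] by exact: xA.
  exists d => // y dy yd; have [->|yx] := eqVneq y x.
    by rewrite subrr dot0r enorm0 mulr0 subr0 addr0.
  have y0 : 0 < enorm (y - x) by rewrite enorm_gt0 subr_eq0.
  have := lt_le_trans Ae (ereal_inf_lbound (imageP _ (dA _ yd yx))).
  rewrite -(fineK (fin _ dx)) -(fineK (fin _ dy)) -!EFinB -EFinM lte_fin.
  rewrite ltr_pdivlMr // => /ltW; lra.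
apply/lee_addgt0Pr => e e0.
have [d d0 hd] := h _ e0.
pose A := [set y | y != x /\ enorm (y - x) < d].
suff : ((- e)%:E <= ereal_sup
    [set ereal_inf ((fun y => (phi y - phi x - (dot v (y - x))%:E) *
       (enorm (y - x))^-1%:E) @` V) | V in x^'])%E.
  move=> /(leeD2r e%:E); apply: le_trans.
  by rewrite -EFinD addNr.
apply: le_trans; last first.
  apply: ereal_sup_ubound; exists A; last by [].
  suff : nbhs x [set y | y != x -> A y] by [].
  by apply/nbhs_enormP; exists d => // y yd yx; split.
apply: le_ereal_inf_tmp => _ [y [yx yd] <-].
have y0 : 0 < enorm (y - x) by rewrite enorm_gt0 subr_eq0.
(* Outside the domain the quotient is [+oo], which is why the real-valued form may ignore such
   points. *)
have [dy|ndy] := ltP (phi y) +oo%E; last first.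
  move: ndy; rewrite leye_eq => /eqP ->.
  rewrite -(fineK (fin _ dx)) -EFinN -EFinN.
  by rewrite !addye // gt0_mulye ?lte_fin ?invr_gt0 // leey.
rewrite -(fineK (fin _ dx)) -(fineK (fin _ dy)) -!EFinB -EFinM lee_fin.
rewrite ler_pdivlMr //; have := hd _ dy yd; lra.
Qed.

(** The quadratic error is below [e |y - x|] once [|y - x| < e / (|C| + 1)]; the sign of [C] is
    free. *)
Lemma proximal_regular {R : realType} {n} (phi : 'rV[R]_n -> \bar R) x v C d :
  (forall y, phi y != -oo%E) -> dom phi x -> 0 < d ->
  (forall y, dom phi y -> enorm (y - x) < d ->
    fine (phi x) + dot v (y - x) - C * enorm (y - x) ^+ 2 <= fine (phi y)) ->
  regular_subdiff phi x v.
Proof.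
move=> noo dx d0 h; apply/(regular_subdiffP _ _ _ noo); split=> // e e0.
have C0 : 0 < `|C| + 1 by rewrite ltr_wpDl.
exists (Num.min d (e / (`|C| + 1))); first by rewrite lt_min d0 divr_gt0.
move=> y dy; rewrite lt_min => /andP[yd]; rewrite ltr_pdivlMr // => ye.
apply: le_trans (h _ dy yd); have := ler_norm C; have := enorm_ge0 (y - x).
nra.
Qed.

Lemma limiting_of_regular {R : realType} {n} (phi : 'rV[R]_n -> \bar R) x v :
  regular_subdiff phi x v -> limiting_subdiff phi x v.
Proof.
move=> hv; split; first by case: hv.
exists (fun=> x), (fun=> v); split=> //; exact: cvg_cst.
Qed.

Lemma indicator_dom {R : realType} {n} (A : set 'rV[R]_n) x :
  dom (indicator A) x <-> A x.
Proof.
rewrite /dom /indicator /=; case: asboolP => h; last by rewrite ltxx.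
by rewrite ltry.
Qed.

Lemma indicatorE {R : realType} {n} (A : set 'rV[R]_n) x :
  A x -> indicator A x = 0%E.
Proof. by rewrite /indicator => Ax; case: asboolP. Qed.

Lemma regular_normal_coneP {R : realType} {n} (A : set 'rV[R]_n) x v :
  regular_normal_cone A x v <-> A x /\
  forall e : R, 0 < e -> exists2 d : R, 0 < d & forall y, A y ->
    enorm (y - x) < d -> dot v (y - x) <= e * enorm (y - x).
Proof.
rewrite /regular_normal_cone regular_subdiffP; last first.
  by move=> y; rewrite /indicator; case: ifP.
split=> [[/indicator_dom Ax h]|[Ax h]].
  split=> // e /h[d d0 hd]; exists d => // y Ay /hd.
  rewrite !indicatorE //= => {}hd.
  by have := hd ((indicator_dom A y).2 Ay); lra.
split; first exact/indicator_dom.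
move=> e /h[d d0 hd]; exists d => // y /indicator_dom Ay /(hd _ Ay).
rewrite !indicatorE //=; lra.
Qed.

(** Convergence of function values is automatic: regular normals exist only at points of [A], where
    the indicator vanishes. *)
Lemma limiting_normal_coneP {R : realType} {n} (A : set 'rV[R]_n) x v :
  limiting_normal_cone A x v <-> A x /\ exists x_ v_ : nat -> 'rV[R]_n,
    [/\ x_ @ \oo --> x, v_ @ \oo --> v &
        forall k, regular_normal_cone A (x_ k) (v_ k)].
Proof.
split=> [[/indicator_dom Ax [x_ [v_ [cx _ h cv]]]]|[Ax [x_ [v_ [cx cv h]]]]].
  by split=> //; exists x_, v_; split.
split; first exact/indicator_dom.
exists x_, v_; split=> //.
have -> : indicator A \o x_ = fun=> 0%E.
  by apply/funext => k /=; have [/indicator_dom/indicatorE] := h k.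
by rewrite indicatorE //; exact: cvg_cst.
Qed.

(** * Quadratic growth, cocoercivity and a mean value inequality *)

(** The difference of squares is [<x - y, (x - a) + (y - a)>]. It supplies Lipschitz constants for
    [min_eball]. *)
Lemma sqr_enorm_lip {R : realType} {n} (a x y : 'rV[R]_n) r :
  eball a r x -> eball a r y ->
  enorm (x - a) ^+ 2 - enorm (y - a) ^+ 2 <= 2 * r * enorm (x - y).
Proof.
rewrite /eball /= => ax ay.
have -> : enorm (x - a) ^+ 2 - enorm (y - a) ^+ 2 =
    dot (x - y) (x - a) + dot (x - y) (y - a).
  by rewrite !enorm_sqr !dotE (dotC y x) (dotC a x) (dotC a y); ring.
have := cauchy_schwarz (x - y) (x - a); have := cauchy_schwarz (x - y) (y - a).
have := enorm_ge0 (x - y); nra.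
Qed.

(* The descent lemma for [e u = max_y (<u, y> - F y)], whose gradient is [P],
   dualizes to quadratic growth of [F]; it follows from subgradient
   inequalities for [e], without differentiating. *)
Lemma argmin_growth {R : realType} {n} (F : 'rV[R]_n -> R) (D : set 'rV[R]_n)
    (P : 'rV[R]_n -> 'rV[R]_n) l d u1 : 0 < l ->
  (forall u, enorm (u - u1) <= d ->
     D (P u) /\ forall y, D y -> F (P u) - dot u (P u) <= F y - dot u y) ->
  (forall u, enorm (u - u1) <= d -> enorm (P u - P u1) <= l * enorm (u - u1)) ->
  forall x, D x -> enorm (x - P u1) <= l * d ->
  F (P u1) + dot u1 (x - P u1) + (2 * l)^-1 * enorm (x - P u1) ^+ 2 <= F x.
Proof.
move=> l0 Pmin Plip x Dx xd.
have [w xE wd] : exists2 w, x = P u1 + l *: w & enorm w <= d.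
  exists (l^-1 *: (x - P u1)); last first.
    by rewrite enormZ gtr0_norm ?invr_gt0 // ler_pdivrMl.
  by rewrite scalerA divff ?gt_eqF // scale1r addrC subrK.
pose u t := u1 + t *: w.
have ud t : 0 <= t -> enorm (u t - u1) = t * enorm w.
  by move=> t0; rewrite /u addrAC subrr add0r enormZ ger0_norm.
have utd t : 0 <= t -> t <= 1 -> enorm (u t - u1) <= d.
  move=> t0 t1; rewrite ud //; apply: le_trans wd.
  by rewrite -{2}(mul1r (enorm w)) ler_wpM2r // enorm_ge0.
(* [e] is the conjugate of [F] along the segment from [u1] to [u1 + w], and [G 1 <= G 0] is its
   descent inequality. The subgradient [P (u t)] and the Lipschitz bound give increments of [G] at
   most [l / 2 (t - s)^2 |w|^2]. *)
pose e t := dot (u t) (P (u t)) - F (P (u t)).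
pose G t := e t - t * dot (P u1) w - l / 2 * t ^+ 2 * enorm w ^+ 2.
have : G 1 <= G 0.
  apply: (@quadratic_increments _ G (l / 2 * enorm w ^+ 2)) => s t s0 st t1.
  have t0 := le_trans s0 st.
  have [DPt _] := Pmin _ (utd _ t0 t1).
  have [_ /(_ _ DPt)] := Pmin _ (utd _ s0 (le_trans st t1)).
  have := cauchy_schwarz w (P (u t) - P u1).
  have := Plip _ (utd _ t0 t1); rewrite ud // !(dotDr, dotNr).
  move: (enorm_ge0 w) (enorm_ge0 (P (u t) - P u1)).
  rewrite /G /e {1 5}/u; set pt := P (u t); set ps := P (u s).
  rewrite {2 3}/u !(dotDl, dotZl) (dotC (P u1) w).
  move=> w0 p0 h1 h2 h3.
  have : (t - s) * (dot w pt - dot w (P u1)) <=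
      (t - s) * (l * (t * enorm w ^+ 2)).
    by rewrite ler_wpM2l ?subr_ge0 //; apply: le_trans h2 _; nra.
  nra.
(* Fenchel's inequality at [u1 + w]; the choice of [w] maximizes [<w, x - P u1> - l / 2 |w|^2], with
   value [|x - P u1|^2 / (2 l)]. *)
have [_ /(_ _ Dx)] := Pmin _ (utd _ ler01 (lexx _)).
have -> : x - P u1 = l *: w by rewrite xE addrAC subrr add0r.
rewrite {1}xE /G /e; have -> : u 0 = u1 by rewrite /u scale0r addr0.
set p := P (u 1); have -> : u 1 = u1 + w by rewrite /u scale1r.
rewrite xE !(dotDl, dotDr, dotZl, dotZr) enormZ gtr0_norm // (dotC (P u1) w).
rewrite -!enorm_sqr.
have -> : (2 * l)^-1 * (l * enorm w) ^+ 2 = l / 2 * enorm w ^+ 2.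
  by field; rewrite gt_eqF.
rewrite expr1n expr0n /=; lra.
Qed.

(** Baillon-Haddad: the growth inequality at [P u1] tested at [P u2], plus the same with roles
    exchanged. The radius [rho / 3] keeps the ball around [u1] through [u2] inside the ball of
    radius [rho]. *)
Lemma argmin_cocoercive {R : realType} {n} (F : 'rV[R]_n -> R)
    (D : set 'rV[R]_n) (P : 'rV[R]_n -> 'rV[R]_n) l rho : 0 < l ->
  (forall u, enorm u <= rho ->
     D (P u) /\ forall y, D y -> F (P u) - dot u (P u) <= F y - dot u y) ->
  (forall u1 u2, enorm u1 <= rho -> enorm u2 <= rho ->
     enorm (P u1 - P u2) <= l * enorm (u1 - u2)) ->
  forall u1 u2, enorm u1 <= rho / 3 -> enorm u2 <= rho / 3 ->
  l^-1 * enorm (P u1 - P u2) ^+ 2 <= dot (u1 - u2) (P u1 - P u2).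
Proof.
move=> l0 Pmin Plip.
have key u1 u2 : enorm u1 <= rho / 3 -> enorm u2 <= rho / 3 ->
    F (P u1) + dot u1 (P u2 - P u1) + (2 * l)^-1 * enorm (P u2 - P u1) ^+ 2 <=
    F (P u2).
  move=> h1 h2.
  have u12 : enorm (u2 - u1) <= rho / 3 + rho / 3.
    by apply: le_trans (enormD _ _) _; rewrite enormN lerD.
  have near u : enorm (u - u1) <= enorm (u2 - u1) -> enorm u <= rho.
    by move=> h; rewrite -(subrK u1 u); have := enormD (u - u1) u1; lra.
  have u1r : enorm u1 <= rho by apply: near; rewrite subrr enorm0 enorm_ge0.
  have u2r : enorm u2 <= rho by exact: near.
  apply: (@argmin_growth _ _ _ D _ _ (enorm (u2 - u1))) => //.
  - by move=> u /near; exact: Pmin.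
  - by move=> u /near h; exact: Plip.
  - by have [] := Pmin _ u2r.
  - exact: Plip.
move=> u1 u2 h1 h2; have := key _ _ h1 h2; have := key _ _ h2 h1.
rewrite (enormB (P u2)) !dotE invfM; lra.
Qed.

(** A small step along [s] raises [f] by about [t |s|^2], while the upper bound allows only
    [K t |s|]. *)
Lemma prox_subgradient_bound {R : realType} {n} (f : 'rV[R]_n -> R) K u s C d :
  0 < d -> 0 <= K ->
  (forall y, enorm (y - u) < d -> f y - f u <= K * enorm (y - u)) ->
  (forall y, enorm (y - u) < d ->
    f u + dot s (y - u) - C * enorm (y - u) ^+ 2 <= f y) ->
  enorm s <= K.
Proof.
move=> d0 K0 fK fs; rewrite leNgt; apply/negP => Ks.
have s0 : 0 < enorm s by exact: le_lt_trans Ks.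
have C0 : 0 < `|C| + 1 by rewrite ltr_wpDl.
(* The step stays within [d / 2], and the quadratic error consumes at most half of the gap
   [|s| - K]. *)
pose t := Num.min (d / (2 * enorm s))
  ((enorm s - K) / (2 * (`|C| + 1) * enorm s)).
have t0 : 0 < t by rewrite lt_min !divr_gt0 ?mulr_gt0 ?subr_gt0.
have uE : u + t *: s - u = t *: s by rewrite addrAC subrr add0r.
have E : enorm (u + t *: s - u) = t * enorm s.
  by rewrite uE enormZ gtr0_norm.
have td : enorm (u + t *: s - u) < d.
  rewrite E; have : t <= d / (2 * enorm s) by rewrite ge_min lexx.
  by rewrite ler_pdivlMr ?mulr_gt0 //; lra.
have := fs _ td; have := fK _ td.
rewrite E uE dotZr -enorm_sqr.
have : t <= (enorm s - K) / (2 * (`|C| + 1) * enorm s).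
  by rewrite ge_min lexx orbT.
rewrite ler_pdivlMr ?mulr_gt0 // => h1 h2 h3.
have h4 := ler_norm C; have ts := mulr_gt0 t0 s0.
have : t * enorm s * (enorm s - C * (t * enorm s) - K) <= 0 by nra.
rewrite pmulr_rle0 //; nra.
Qed.

(* Minimizing [f x + L |x - a| + C |x - a|^2] over a ball around [a]: with [C]
   large the minimizer is interior, and unless it is [a] itself it carries a
   proximal subgradient of [f] of norm larger than [L]. *)
Lemma prox_mean_value {R : realType} {n} (f : 'rV[R]_n -> R) K L rho :
  0 <= K -> 0 <= L -> 0 < rho ->
  (forall x y, enorm x < 4 * rho -> enorm y < 4 * rho ->
     f x - f y <= K * enorm (x - y)) ->
  (forall u s C d, enorm u < 4 * rho -> 0 < d ->
     (forall y, enorm (y - u) < d ->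
        f u + dot s (y - u) - C * enorm (y - u) ^+ 2 <= f y) ->
     enorm s <= L) ->
  forall a b, enorm a <= rho -> enorm b <= rho ->
  f a - f b <= L * enorm (a - b).
Proof.
move=> K0 L0 rho0 fK fs.
(* On the sphere of radius [2 rho] the penalty [C |x - a|^2] is [(K + 1) |x - a|], more than [f] can
   decrease, so no minimizer lies there. *)
pose C := (K + 1) / (2 * rho).
have C0 : 0 < C by rewrite divr_gt0 ?mulr_gt0 // ltr_wpDl.
have CK : C * (2 * rho) = K + 1 by rewrite divfK // gt_eqF // mulr_gt0.
have step a x : enorm a <= rho -> enorm (x - a) <= 2 * rho ->
    f a <= f x + L * enorm (x - a) + C * enorm (x - a) ^+ 2.
  move=> ar xa.
  have near y : enorm (y - a) <= 2 * rho -> enorm y < 4 * rho.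
    by move=> h; rewrite -(subrK a y); have := enormD (y - a) a; lra.
  have a2 : 0 <= 2 * rho by rewrite mulr_ge0 // ltW.
  pose h y := f y + L * enorm (y - a) + C * enorm (y - a) ^+ 2.
  have [||||| p [/= ap _ pmin]] := @min_eball _ _ (fun=> 0%E) h a (2 * rho)
      (K + L + C * (2 * (2 * rho))).
  - by move=> y c c0; exists setT => //; exact: filterT.
  - by [].
  - by exists a; rewrite /eball /dom /= ?subrr ?enorm0 ?ltry.
  - by rewrite !addr_ge0 // mulr_ge0 ?(ltW C0) // mulr_ge0.
  - move=> y z ay az; have := sqr_enorm_lip _ _ _ _ ay az.
    have := fK _ _ (near _ ay) (near _ az); have := enorm_dist z y a.
    rewrite /h; nra.
  have {}pmin y : enorm (y - a) <= 2 * rho -> h p <= h y.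
    by move=> ya; have := pmin y ya; rewrite /dom /= ltry !add0r; exact.
  have [pa|pa] := eqVneq p a.
    by have := pmin _ xa; rewrite pa /h subrr enorm0 expr0n /= !mulr0 !addr0.
  exfalso; set t := enorm (p - a).
  have t0 : 0 < t by rewrite enorm_gt0 subr_eq0.
  have tlt : t < 2 * rho.
    have aa : enorm (a - a) <= 2 * rho by rewrite subrr enorm0.
    have := pmin _ aa; have := fK _ _ (near _ aa) (near _ ap).
    rewrite /h subrr enorm0 expr0n /= !mulr0 !addr0 (enormB a p) -/t => h1 h2.
    have : C * t <= K by rewrite -(ler_pM2r t0); nra.
    by rewrite -(ltr_pM2l C0) CK; lra.
  (* [c (p - a)] is the gradient of the penalty at [p]; its norm [L + 2 C t] exceeds [L]. *)
  pose c := L / t + 2 * C.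
  have c0 : 0 < c by rewrite ltr_wpDl ?divr_ge0 ?(ltW t0) // mulr_gt0.
  have := fs p (- (c *: (p - a))) (L / (2 * t) + C) (2 * rho - t) (near _ ap).
  rewrite subr_gt0 tlt enormN enormZ gtr0_norm // -/t => /(_ isT).
  have -> : c * t = L + 2 * C * t by rewrite /c; field; rewrite gt_eqF.
  suff hp y : enorm (y - p) < 2 * rho - t ->
      f p + dot (- (c *: (p - a))) (y - p) -
      (L / (2 * t) + C) * enorm (y - p) ^+ 2 <= f y.
    by move=> /(_ hp); have := mulr_gt0 C0 t0; lra.
  move=> yp.
  have ya : enorm (y - a) <= 2 * rho.
    by have := enorm_dist p y a; rewrite -/t; lra.
  have := pmin _ ya; rewrite /h -/t; set T := enorm (y - a).
  have TE : T ^+ 2 = t ^+ 2 + 2 * dot (p - a) (y - p) + enorm (y - p) ^+ 2.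
    rewrite !enorm_sqr !dotE (dotC y p) (dotC a p) (dotC a y); ring.
  rewrite !(dotNl, dotZl).
  (* The tangent bound for the square root turns the norm into a quadratic, making the subgradient
     proximal. *)
  have hT : T - t <= (T ^+ 2 - t ^+ 2) / (2 * t).
    by rewrite ler_pdivlMr ?mulr_gt0 //; have := sqr_ge0 (T - t); nra.
  have := ler_wpM2l L0 hT; rewrite TE.
  set D := dot _ _; set E := enorm _ ^+ 2.
  have -> : L * ((t ^+ 2 + 2 * D + E - t ^+ 2) / (2 * t)) =
    (L / t) * D + (L / (2 * t)) * E by field; rewrite gt_eqF.
  rewrite /c; lra.
move=> a b ar br.
pose x t := a + t *: (b - a).
have xr t : 0 <= t -> t <= 1 -> enorm (x t) <= rho.
  move=> t0 t1; have -> : x t = (1 - t) *: a + t *: b.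
    by rewrite /x scalerBr scalerBl scale1r addrA addrAC.
  apply: le_trans (enormD _ _) _; rewrite !enormZ !ger0_norm ?subr_ge0 //; nra.
(* The quadratic remainder of [step] disappears when the segment from [a] to [b] is subdivided. *)
pose G t := - f (x t) - t * (L * enorm (b - a)).
have : G 1 <= G 0.
  apply: (@quadratic_increments _ G (C * enorm (b - a) ^+ 2)) => s t s0 st t1.
  have t0 := le_trans s0 st; have s1 := le_trans st t1.
  have E : x t - x s = (t - s) *: (b - a).
    by rewrite /x opprD addrACA subrr add0r -scalerBl.
  have := step (x s) (x t) (xr _ s0 s1).
  rewrite E enormZ ger0_norm ?subr_ge0 //.
  have bb : enorm (b - a) <= 2 * rho.
    by apply: le_trans (enormD _ _) _; rewrite enormN; lra.
  have : (t - s) * enorm (b - a) <= 2 * rho.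
    by have := enorm_ge0 (b - a); nra.
  move=> h /(_ h); rewrite /G exprMn; lra.
rewrite /G /x scale0r scale1r addr0 [a + _]addrC subrK (enormB a); lra.
Qed.

(** * Prox-regularity and the local resolvent *)

Definition local_prox {R : realType} {n} (phi : 'rV[R]_n -> \bar R)
    (xbar : 'rV[R]_n) (eps r : R) : Prop :=
  forall x u v, dom phi x -> eball xbar eps x ->
    limiting_subdiff phi u v -> eball xbar eps u -> enorm v <= eps ->
    fine (phi u) + dot v (x - u) - r / 2 * enorm (x - u) ^+ 2 <= fine (phi x).

Lemma dom_fin_num {R : realType} {n} (phi : 'rV[R]_n -> \bar R) x :
  (forall y, phi y != -oo%E) -> dom phi x -> phi x \is a fin_num.
Proof. by move=> noo dx; rewrite fin_numE noo lt_eqF. Qed.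

(** Subdifferential continuity makes the restriction [phi u < phi xbar + eps] automatic on a smaller
    ball. *)
Lemma prox_regular_local {R : realType} {n} (phi : 'rV[R]_n -> \bar R) xbar :
  (forall y, phi y != -oo%E) -> dom phi xbar ->
  continuously_prox_regular phi xbar 0 ->
  exists eps r, [/\ 0 < eps, 0 <= r & local_prox phi xbar eps r].
Proof.
move=> noo dxb [[_ _ [e [r [e0 r0 hpr]]]] hsc].
have [d d0 hd] := hsc e e0.
exists (Num.min e d), r; split=> //; first by rewrite lt_min e0.
move=> x u v dx; rewrite /eball /= !le_min => /andP[xe _] huv.
move=> /andP[ue ud] /andP[ve vd].
have du : dom phi u by case: huv.
have := hd u v huv; rewrite /eball /= subr0 => /(_ ud vd).
have := hpr x u v xe huv ue; rewrite /eball /= subr0 => /(_ ve).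
rewrite -(fineK (dom_fin_num _ _ noo dx)) -(fineK (dom_fin_num _ _ noo du)).
rewrite -(fineK (dom_fin_num _ _ noo dxb)) -!EFinD abse_EFin.
rewrite !lte_fin lee_fin => h; rewrite ltr_norml => /andP[_ h'].
by apply: h; lra.
Qed.

(** Sum of the two prox-regularity inequalities with the graph points exchanged. *)
Lemma local_prox_hypomonotone {R : realType} {n} (phi : 'rV[R]_n -> \bar R)
    xbar eps r x1 v1 x2 v2 : local_prox phi xbar eps r ->
  limiting_subdiff phi x1 v1 -> eball xbar eps x1 -> enorm v1 <= eps ->
  limiting_subdiff phi x2 v2 -> eball xbar eps x2 -> enorm v2 <= eps ->
  - r * enorm (x1 - x2) ^+ 2 <= dot (v1 - v2) (x1 - x2).
Proof.
move=> hp h1 xe1 ve1 h2 xe2 ve2.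
have d1 : dom phi x1 by case: h1.
have d2 : dom phi x2 by case: h2.
have := hp _ _ _ d1 xe1 h2 xe2 ve2; have := hp _ _ _ d2 xe2 h1 xe1 ve1.
rewrite (enormB x2) !dotE; lra.
Qed.

(* Shifting the graph by [lam = r + 1] makes it strongly monotone. *)
Lemma local_prox_shift {R : realType} {n} (phi : 'rV[R]_n -> \bar R)
    xbar eps r x1 v1 x2 v2 : local_prox phi xbar eps r ->
  limiting_subdiff phi x1 v1 -> eball xbar eps x1 -> enorm v1 <= eps ->
  limiting_subdiff phi x2 v2 -> eball xbar eps x2 -> enorm v2 <= eps ->
  enorm (x1 - x2) <=
  enorm ((v1 + (r + 1) *: (x1 - xbar)) - (v2 + (r + 1) *: (x2 - xbar))).
Proof.
move=> hp h1 xe1 ve1 h2 xe2 ve2.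
have h := local_prox_hypomonotone _ _ _ _ _ _ _ _ hp h1 xe1 ve1 h2 xe2 ve2.
apply: le_enormP; first exact: enorm_ge0.
apply: le_trans (cauchy_schwarz _ _).
have -> : v1 + (r + 1) *: (x1 - xbar) - (v2 + (r + 1) *: (x2 - xbar)) =
    (v1 - v2) + (r + 1) *: (x1 - x2).
  rewrite opprD addrACA; congr (_ + _).
  by rewrite -scalerBr opprB addrA subrK.
rewrite [leRHS]dotDl dotZl; rewrite enorm_sqr in h; lra.
Qed.

Lemma tilt_argminP {R : realType} {n} (phi : 'rV[R]_n -> \bar R)
    xbar gamma v x :
  (forall y, phi y != -oo%E) -> dom phi xbar -> 0 <= gamma ->
  tilt_argmin phi xbar gamma v x <->
  [/\ eball xbar gamma x, dom phi x & forall y, eball xbar gamma y ->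
      dom phi y -> fine (phi x) - dot v x <= fine (phi y) - dot v y].
Proof.
move=> noo dxb g0; have fin := dom_fin_num phi _ noo.
have xbb : eball xbar gamma xbar by rewrite /eball /= subrr enorm0.
split=> [[gx h]|[gx dx h]].
  have dx : dom phi x.
    have := h _ xbb; rewrite -(fineK (fin _ dxb)) -EFinB /dom /= ltey.
    by move=> hx; apply/eqP => xE; move: hx; rewrite xE /= leye_eq.
  split=> // y gy dy; have := h y gy.
  by rewrite -(fineK (fin _ dx)) -(fineK (fin _ dy)) -!EFinB lee_fin.
split=> // y gy; have [dy|] := ltP (phi y) +oo%E.
  have := h y gy dy.
  by rewrite -(fineK (fin _ dx)) -(fineK (fin _ dy)) -!EFinB lee_fin.
by rewrite leye_eq => /eqP ->; rewrite addye // leey.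
Qed.

(** Fermat's rule: expanding the square turns minimality into a proximal inequality with constant
    [lam / 2]. With [lam = 0] it also serves tilted minimizers. *)
Lemma interior_argmin_subdiff {R : realType} {n} (phi : 'rV[R]_n -> \bar R)
    xbar gamma u lam x :
  (forall y, phi y != -oo%E) -> enorm (x - xbar) < gamma -> dom phi x ->
  (forall y, eball xbar gamma y -> dom phi y ->
     fine (phi x) + (lam / 2 * enorm (x - xbar) ^+ 2 - dot u x) <=
     fine (phi y) + (lam / 2 * enorm (y - xbar) ^+ 2 - dot u y)) ->
  limiting_subdiff phi x (u - lam *: (x - xbar)).
Proof.
move=> noo xg dx xmin; apply: limiting_of_regular.
apply: (@proximal_regular _ _ _ _ _ (lam / 2) (gamma - enorm (x - xbar))) => //.
  by rewrite subr_gt0.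
move=> y dy yx; have yg : eball xbar gamma y.
  by rewrite /eball /=; have := enorm_dist x y xbar; lra.
have := xmin _ yg dy; rewrite !enorm_sqr !dotE.
rewrite (dotC y x) (dotC xbar x) (dotC xbar y); lra.
Qed.

(** [P] inverts [(x, v) |-> v + lam (x - xbar)] on the graph near [(xbar, 0)]. For [lam >= 1],
    [res_eps] keeps [P u] and its subgradient [u - lam (P u - xbar)] within [eps / 2] of [xbar] and
    [0]. *)
Record resolvent {R : realType} {n} (phi : 'rV[R]_n -> \bar R)
    (xbar : 'rV[R]_n) (eps lam rho : R) (P : 'rV[R]_n -> 'rV[R]_n) : Prop := {
  res_dom : forall u, enorm u <= rho -> dom phi (P u);
  res_near : forall u, enorm u <= rho -> enorm (P u - xbar) <= 2 * enorm u;
  res_min : forall u y, enorm u <= rho -> eball xbar eps y -> dom phi y ->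
    fine (phi (P u)) + (lam / 2 * enorm (P u - xbar) ^+ 2 - dot u (P u)) <=
    fine (phi y) + (lam / 2 * enorm (y - xbar) ^+ 2 - dot u y);
  res_subdiff : forall u, enorm u <= rho ->
    limiting_subdiff phi (P u) (u - lam *: (P u - xbar));
  res_lip : forall u1 u2, enorm u1 <= rho -> enorm u2 <= rho ->
    enorm (P u1 - P u2) <= enorm (u1 - u2);
  res_unique : forall x v, limiting_subdiff phi x v -> eball xbar eps x ->
    enorm v <= eps -> enorm (v + lam *: (x - xbar)) <= rho ->
    P (v + lam *: (x - xbar)) = x;
  res_rho : 0 < rho;
  res_eps : (1 + 2 * lam) * rho <= eps / 2 }.

Lemma resolvent_exists {R : realType} {n} (phi : 'rV[R]_n -> \bar R)
    xbar eps r :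
  (forall y, phi y != -oo%E) -> lower_semicontinuous phi ->
  limiting_subdiff phi xbar 0 -> 0 < eps -> 0 <= r ->
  local_prox phi xbar eps r ->
  exists rho P, resolvent phi xbar eps (r + 1) rho P.
Proof.
move=> noo lsc h0 e0 r0 hp; set lam := r + 1.
have lam1 : 1 <= lam by rewrite lerDr.
have dxb : dom phi xbar by case: h0.
have xbe : eball xbar eps xbar by rewrite /eball /= subrr enorm0 ltW.
pose h u y := lam / 2 * enorm (y - xbar) ^+ 2 - dot u y.
have ex u : exists x, [/\ eball xbar eps x, dom phi x & forall y,
    eball xbar eps y -> dom phi y ->
    fine (phi x) + h u x <= fine (phi y) + h u y].
  apply: (@min_eball _ _ phi (h u) _ _ (lam * eps + enorm u)) => //.
  - by exists xbar.
  - by rewrite addr_ge0 ?enorm_ge0 // mulr_ge0 ?(ltW e0) // (le_trans ler01).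
  move=> x y xe ye; have := sqr_enorm_lip _ _ _ _ xe ye.
  have := cauchy_schwarz u (y - x); rewrite (enormB y) /h !dotE; nra.
have [P hP] := choice ex.
pose rho := eps / (2 * (1 + 2 * lam)).
have lam2 : 0 < 2 * (1 + 2 * lam) by lra.
have rho0 : 0 < rho by rewrite divr_gt0.
have rhoE : (1 + 2 * lam) * rho = eps / 2 by rewrite /rho; field; lra.
(* Comparing [P u] with [xbar], prox-regularity at [(xbar, 0)] absorbs [r / 2] of the coefficient
   [lam / 2] and leaves [|P u - xbar|^2 / 2 <= <u, P u - xbar>]. *)
have near u : enorm (P u - xbar) <= 2 * enorm u.
  have [Pe dP /(_ _ xbe dxb)] := hP u.
  have v0 : enorm (0 : 'rV[R]_n) <= eps by rewrite enorm0 ltW.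
  have := hp _ _ _ dP Pe h0 xbe v0.
  rewrite /h subrr enorm0 expr0n /= mulr0 sub0r dot0l => h1 h2.
  have := cauchy_schwarz u (P u - xbar); rewrite dotDr dotNr => h3.
  have h4 : enorm (P u - xbar) ^+ 2 <= 2 * (enorm u * enorm (P u - xbar)).
    rewrite /lam in h2; lra.
  by apply: le_enormP; rewrite ?mulr_ge0 ?enorm_ge0 // -enorm_sqr; lra.
have sub u : enorm u <= rho ->
    limiting_subdiff phi (P u) (u - lam *: (P u - xbar)).
  move=> ur; have [Pe dP hmin] := hP u.
  apply: (@interior_argmin_subdiff _ _ _ _ eps) => //.
  by have := near u; nra.
have small u : enorm u <= rho -> enorm (u - lam *: (P u - xbar)) <= eps.
  move=> ur; apply: le_trans (enormD _ _) _; rewrite enormN enormZ gtr0_norm.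
    by have := near u; nra.
  by lra.
exists rho, P; split=> //.
- by move=> u _; have [] := hP u.
- by move=> u y _ ye dy; have [_ _] := hP u; apply.
- move=> u1 u2 u1r u2r; have [e1 _ _] := hP u1; have [e2 _ _] := hP u2.
  have := local_prox_shift _ _ _ _ _ _ _ _ hp (sub _ u1r) e1 (small _ u1r)
    (sub _ u2r) e2 (small _ u2r).
  by rewrite !subrK.
- move=> x v hxv xe ve; set u := v + _ => ur; have [Pe _ _] := hP u.
  have := local_prox_shift _ _ _ _ _ _ _ _ hp (sub _ ur) Pe (small _ ur)
    hxv xe ve.
  rewrite subrK -/lam -/u subrr enorm0 => hle.
  by apply/eqP; rewrite -subr_eq0 -enorm_eq0 eq_le hle enorm_ge0.
- by rewrite rhoE.
Qed.

(** * From graph normals to tilt stability *)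

(** Minimizers for tilts [v1] and [v2] are resolvent values at [vi + lam (xi - xbar)], so [|x1 - x2|
    <= l (|v1 - v2| + lam |x1 - x2|)]; solving for [|x1 - x2|] gives the modulus. *)
Lemma tilt_of_lipschitz_resolvent {R : realType} {n}
    (phi : 'rV[R]_n -> \bar R) xbar eps lam rho P l s :
  (forall y, phi y != -oo%E) -> lower_semicontinuous phi -> dom phi xbar ->
  resolvent phi xbar eps lam rho P -> 0 <= lam -> 0 < l -> lam * l < 1 ->
  0 < s -> s <= rho ->
  (forall u1 u2, enorm u1 <= s -> enorm u2 <= s ->
     enorm (P u1 - P u2) <= l * enorm (u1 - u2)) ->
  tilt_stable phi xbar (l^-1 - lam)^-1.
Proof.
move=> noo lsc dxb [Pdom Pnear Pmin Psub _ Puniq rho0 heps].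
move=> lam0 l0 laml s0 srho Plip; set kappa := (l^-1 - lam)^-1.
have mu0 : 0 < l^-1 - lam by rewrite subr_gt0 -div1r ltr_pdivlMr.
have k0 : 0 < kappa by rewrite invr_gt0.
have kE : kappa^-1 = l^-1 - lam by rewrite invrK.
clearbody kappa; have e0 : 0 < eps by nra.
have P0 : P 0 = xbar.
  have := Pnear 0; rewrite enorm0 mulr0 => /(_ (ltW rho0)) h.
  by apply/eqP; rewrite -subr_eq0 -enorm_eq0 eq_le h enorm_ge0.
(* The regularized function grows with coefficient [1 / (2 l)]; removing [lam / 2] leaves
   [1 / (2 kappa)]. *)
have growth x : dom phi x -> enorm (x - xbar) <= eps ->
    enorm (x - xbar) <= l * s ->
    fine (phi xbar) + kappa^-1 / 2 * enorm (x - xbar) ^+ 2 <= fine (phi x).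
  move=> dx xe xs.
  pose F y := fine (phi y) + lam / 2 * enorm (y - xbar) ^+ 2.
  have : F (P 0) + dot 0 (x - P 0) + (2 * l)^-1 * enorm (x - P 0) ^+ 2 <= F x.
    apply: (@argmin_growth _ _ F [set y | eball xbar eps y /\ dom phi y] P l s).
    - by [].
    - move=> u; rewrite subr0 => us; have ur := le_trans us srho.
      split=> [|y [ye dy]]; last by have := Pmin u y ur ye dy; rewrite /F; lra.
      split; last exact: Pdom.
      by rewrite /eball /=; have := Pnear _ ur; nra.
    - move=> u; rewrite subr0 => us.
      by rewrite -{2}(subr0 u) Plip // enorm0 ltW.
    - by [].
    - by rewrite P0.
  rewrite P0 dot0l /F subrr enorm0 expr0n /= kE invfM; lra.
pose gam := Num.min eps (l * s).
have gam0 : 0 < gam by rewrite lt_min e0 mulr_gt0.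
have game : gam <= eps by rewrite ge_min lexx.
have gams : gam <= l * s by rewrite ge_min lexx orbT.
pose argm v x := [/\ eball xbar gam x, dom phi x & forall y, eball xbar gam y ->
      dom phi y -> fine (phi x) - dot v x <= fine (phi y) - dot v y].
have ex v : exists x, argm v x.
  apply: (@min_eball _ _ phi (fun x => - dot v x) _ _ (enorm v)) => //.
  - by exists xbar => //; rewrite /eball /= subrr enorm0 ltW.
  - exact: enorm_ge0.
  move=> x y _ _; have := cauchy_schwarz v (y - x).
  by rewrite (enormB y) dotDr dotNr; lra.
have [m hm] := choice ex.
have near v x : argm v x -> enorm (x - xbar) <= 2 * kappa * enorm v.
  move=> [gx dx /(_ xbar)]; rewrite /eball /= subrr enorm0.
  move=> /(_ (ltW gam0) dxb).
  have := growth x dx (le_trans gx game) (le_trans gx gams) => h1 h2.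
  have := cauchy_schwarz v (x - xbar); rewrite dotDr dotNr => h3.
  apply: le_enormP; first by rewrite !mulr_ge0 ?enorm_ge0 // ltW.
  have -> : dot (x - xbar) (x - xbar) =
      2 * kappa * (kappa^-1 / 2 * enorm (x - xbar) ^+ 2).
    by rewrite enorm_sqr; field; rewrite gt_eqF.
  by rewrite -[leRHS]mulrA ler_wpM2l ?mulr_ge0 ?(ltW k0) //; lra.
(* The three bounds make tilted minimizers interior, keep [v] within [eps], and keep
   [v + lam (x - xbar)] in the ball of radius [s]. *)
pose sg := Num.min (gam / (2 * kappa))
  (Num.min eps (s / (1 + lam * (2 * kappa)))).
have lk0 : 0 < 1 + lam * (2 * kappa) by rewrite ltr_wpDr // !mulr_ge0 // ltW.
have sg0 : 0 < sg by rewrite !lt_min e0 !divr_gt0 ?mulr_gt0.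
have fix_P v x : enorm v < sg -> argm v x ->
    enorm (v + lam *: (x - xbar)) <= s /\ x = P (v + lam *: (x - xbar)).
  rewrite !lt_min => /and3P[]; rewrite !ltr_pdivlMr ?mulr_gt0 // => v1 v2 v3 ax.
  have nx := near _ _ ax; case: ax => gx dx xmin.
  have xs : enorm (v + lam *: (x - xbar)) <= s.
    apply: le_trans (enormD _ _) _; rewrite enormZ ger0_norm //.
    have := ler_wpM2l lam0 nx; lra.
  split=> //; rewrite Puniq //.
  - rewrite -[v]subr0 -(scale0r (x - xbar)).
    apply: (@interior_argmin_subdiff _ _ _ _ gam) => //.
      by apply: le_lt_trans nx _; rewrite mulrC.
    by move=> y gy dy; have := xmin y gy dy; rewrite !mul0r !sub0r.
  - exact: le_trans gx game.
  - exact: ltW.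
  - exact: le_trans srho.
have lip v1 v2 x1 x2 : enorm v1 < sg -> enorm v2 < sg -> argm v1 x1 ->
    argm v2 x2 -> enorm (x1 - x2) <= kappa * enorm (v1 - v2).
  move=> v1s v2s /(fix_P _ _ v1s)[u1s x1E] /(fix_P _ _ v2s)[u2s x2E].
  have := Plip _ _ u1s u2s; rewrite -x1E -x2E.
  have -> : v1 + lam *: (x1 - xbar) - (v2 + lam *: (x2 - xbar)) =
      (v1 - v2) + lam *: (x1 - x2).
    rewrite opprD addrACA; congr (_ + _).
    by rewrite -scalerBr opprB addrA subrK.
  have := enormD (v1 - v2) (lam *: (x1 - x2)); rewrite enormZ ger0_norm //.
  move=> h1 h2.
  rewrite -[kappa]invrK kE mulrC ler_pdivlMr //.
  have : l * (enorm (x1 - x2) * (l^-1 - lam)) <= l * enorm (v1 - v2).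
    have -> : l * (enorm (x1 - x2) * (l^-1 - lam)) =
       enorm (x1 - x2) - l * lam * enorm (x1 - x2) by field; rewrite gt_eqF.
    have := ler_wpM2l (ltW l0) h1; lra.
  by rewrite ler_pM2l.
have argE v : enorm v < sg -> tilt_argmin phi xbar gam v = [set m v].
  move=> vs; apply/seteqP; split=> [x /tilt_argminP|_ ->].
    move=> /(_ noo dxb (ltW gam0)) ax.
    have := lip _ _ _ _ vs vs ax (hm v).
    rewrite subrr enorm0 mulr0 => h.
    by apply/eqP; rewrite -subr_eq0 -enorm_eq0 eq_le h enorm_ge0.
  by apply/(tilt_argminP _ _ _ _ _ noo dxb (ltW gam0)); exact: hm.
split=> //; exists gam => //; split.
  rewrite argE ?enorm0 //; congr [set _].
  have := near _ _ (hm 0); rewrite enorm0 mulr0 => h.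
  by apply/eqP; rewrite -subr_eq0 -enorm_eq0 eq_le h enorm_ge0.
exists [set v | enorm v < sg], m; split=> //.
  by apply/nbhs_enormP; exists sg => // v; rewrite subr0.
by move=> v1 v2 v1s v2s; exact: (lip _ _ _ _ v1s v2s (hm _) (hm _)).
Qed.

Lemma proximal_normal {R : realType} {n} (A : set 'rV[R]_n) x v C d :
  A x -> 0 < d ->
  (forall y, A y -> enorm (y - x) < d ->
     dot v (y - x) <= C * enorm (y - x) ^+ 2) ->
  regular_normal_cone A x v.
Proof.
move=> Ax d0 h; apply: (@proximal_regular _ _ _ _ _ C d) => //.
- by move=> y; rewrite /indicator; case: ifP.
- exact/indicator_dom.
- move=> y /indicator_dom Ay yd; rewrite !indicatorE //=.
  by have := h y Ay yd; lra.
Qed.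

(** A nearby graph point [(x', v')] is the resolvent point of [u'] with
    [u' - u = (v' - v) + lam (x' - x)]. Substituting this in the inequality for [s] collects the
    coefficients [lam s - q] and [s], with a quadratic error since [|u' - u|] is at most [1 + lam]
    times the graph displacement. *)
Lemma resolvent_normal {R : realType} {n} (phi : 'rV[R]_n -> \bar R)
    xbar eps lam rho P u q s C d :
  resolvent phi xbar eps lam rho P -> 1 <= lam -> enorm u < rho -> 0 < d ->
  (forall y, enorm (y - u) < d ->
    dot q (P u) + dot s (y - u) - C * enorm (y - u) ^+ 2 <= dot q (P y)) ->
  regular_normal_cone (gph (limiting_subdiff phi))
    (row_mx (P u) (u - lam *: (P u - xbar))) (row_mx (lam *: s - q) s).
Proof.
move=> [_ Pnear _ Psub _ Puniq rho0 heps] lam1 ur d0 hs.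
have ur' := ltW ur.
pose e := Num.min (eps / 2)
  (Num.min ((rho - enorm u) / (1 + lam)) (d / (1 + lam))).
have lam0 : 0 < 1 + lam by lra.
have e0 : 0 < e by rewrite !lt_min !divr_gt0 ?subr_gt0 //; nra.
apply: (@proximal_normal _ _ _ _ _ (`|C| * (1 + lam) ^+ 2) e) => //.
  by exists (P u, u - lam *: (P u - xbar)) => //; exact: Psub.
move=> _ [[x' v'] /= hxv <-].
rewrite row_mxB dot_row_mx; set v := u - _; set x := P u.
set tau := enorm _.
have [xt vt] := enorm_row_mx_ge (x' - x) (v' - v); rewrite -/tau in xt vt.
rewrite !lt_min => /and3P[]; rewrite !ltr_pdivlMr // => t1 t2 t3.
pose u' := v' + lam *: (x' - xbar).
have uu : u' - u = (v' - v) + lam *: (x' - x).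
  have {1}-> : u = v + lam *: (x - xbar) by rewrite subrK.
  rewrite /u' opprD addrACA; congr (_ + _).
  by rewrite -scalerBr opprB addrA subrK.
have uut : enorm (u' - u) <= (1 + lam) * tau.
  rewrite uu; apply: le_trans (enormD _ _) _.
  rewrite enormZ ger0_norm; last by lra.
  have lam0' : 0 <= lam by lra.
  have := ler_wpM2l lam0' xt; lra.
have u'r : enorm u' <= rho.
  rewrite -(subrK u u'); apply: le_trans (enormD _ _) _; lra.
have Pu' : P u' = x'.
  apply: Puniq => //.
  - rewrite /eball /=; have := enorm_dist x x' xbar; have := Pnear _ ur'.
    rewrite -/x; nra.
  - rewrite -(subrK v v'); apply: le_trans (enormD _ _) _.
    have : enorm v <= enorm u + lam * enorm (x - xbar).
      apply: le_trans (enormD _ _) _; rewrite enormN enormZ ger0_norm //; lra.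
    have := Pnear _ ur'; rewrite -/x; nra.
have u'd : enorm (u' - u) < d by lra.
have := hs _ u'd; rewrite Pu' -/x {1}uu !dotE => h.
have h2 : enorm (u' - u) ^+ 2 <= (1 + lam) ^+ 2 * tau ^+ 2.
  by rewrite -exprMn ler_pXn2r ?nnegrE ?enorm_ge0 // mulr_ge0 ?enorm_ge0 // ltW.
have h3 : C * enorm (u' - u) ^+ 2 <= `|C| * ((1 + lam) ^+ 2 * tau ^+ 2).
  apply: le_trans (ler_wpM2r _ (ler_norm C)) _; first exact: sqr_ge0.
  exact: ler_wpM2l.
lra.
Qed.

(** The mean value inequality is applied to [<q, P>] with [q] the unit vector along [P u1 - P u2].
    Since [P] is nonexpansive, its proximal subgradients satisfy [|s| <= 1], so [hn] may be limited
    to bounded [s], as the later compactness argument requires. *)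
Lemma resolvent_lipschitz {R : realType} {n} (phi : 'rV[R]_n -> \bar R)
    xbar eps lam rho P sg l :
  resolvent phi xbar eps lam rho P -> 1 <= lam -> 0 < sg -> sg <= rho ->
  0 <= l ->
  (forall u q s, enorm u < sg -> enorm q = 1 -> enorm s <= 1 ->
     regular_normal_cone (gph (limiting_subdiff phi))
       (row_mx (P u) (u - lam *: (P u - xbar))) (row_mx (lam *: s - q) s) ->
     enorm s <= l) ->
  forall u1 u2, enorm u1 <= sg / 4 -> enorm u2 <= sg / 4 ->
  enorm (P u1 - P u2) <= l * enorm (u1 - u2).
Proof.
move=> res lam1 sg0 sgr l0 hn u1 u2 u1s u2s.
have [->|Pne] := eqVneq (P u1) (P u2).
  by rewrite subrr enorm0 mulr_ge0 ?enorm_ge0.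
have N0 : 0 < enorm (P u1 - P u2) by rewrite enorm_gt0 subr_eq0.
pose q := (enorm (P u1 - P u2))^-1 *: (P u1 - P u2).
have q1 : enorm q = 1.
  by rewrite enormZ gtr0_norm ?invr_gt0 // mulVf // gt_eqF.
have fE y z : dot q (P y) - dot q (P z) = dot q (P y - P z).
  by rewrite dotDr dotNr.
have E4 : 4 * (sg / 4) = sg by field.
have fK y z : enorm y < 4 * (sg / 4) -> enorm z < 4 * (sg / 4) ->
    dot q (P y) - dot q (P z) <= 1 * enorm (y - z).
  rewrite E4 => ys zs; rewrite fE mul1r.
  apply: le_trans (cauchy_schwarz _ _) _; rewrite q1 mul1r.
  by apply: (res_lip _ _ _ _ _ _ res); apply: ltW; exact: lt_le_trans sgr.
have := @prox_mean_value _ _ (fun y => dot q (P y)) 1 l (sg / 4) ler01 l0.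
rewrite divr_gt0 // => /(_ isT fK) mv.
have <- : dot q (P u1 - P u2) = enorm (P u1 - P u2).
  by rewrite dotZl -enorm_sqr expr2 mulKf // gt_eqF.
rewrite -fE.
apply: mv => // u s C d; rewrite E4 => us d0 hs.
apply: (hn u q s) => //; last first.
  exact: (resolvent_normal _ _ _ _ _ _ _ _ _ _ _ res lam1
    (lt_le_trans us sgr) d0 hs).
apply: (@prox_subgradient_bound _ _ (fun y => dot q (P y)) _ u _ C
  (Num.min d (sg - enorm u))) => //.
- by rewrite lt_min d0 subr_gt0.
- move=> y; rewrite lt_min => /andP[_ yu]; apply: fK; rewrite E4 //.
  by rewrite -(subrK u y); apply: le_lt_trans (enormD _ _) _; lra.
- by move=> y; rewrite lt_min => /andP[yd _]; exact: hs.
Qed.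

Lemma tilt_of_normals {R : realType} {n} (phi : 'rV[R]_n -> \bar R)
    xbar eps lam rho P sg l :
  (forall y, phi y != -oo%E) -> lower_semicontinuous phi -> dom phi xbar ->
  resolvent phi xbar eps lam rho P -> 1 <= lam -> 0 < sg -> sg <= rho ->
  0 < l -> lam * l < 1 ->
  (forall u q s, enorm u < sg -> enorm q = 1 -> enorm s <= 1 ->
     regular_normal_cone (gph (limiting_subdiff phi))
       (row_mx (P u) (u - lam *: (P u - xbar))) (row_mx (lam *: s - q) s) ->
     enorm s <= l) ->
  tilt_stable phi xbar (l^-1 - lam)^-1.
Proof.
move=> noo lsc dxb res lam1 sg0 sgr l0 laml hn.
have lip := resolvent_lipschitz _ _ _ _ _ _ _ _ res lam1 sg0 sgr (ltW l0) hn.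
apply: (tilt_of_lipschitz_resolvent _ _ _ _ _ _ _ _ noo lsc dxb res _ l0 laml
  _ _ lip); lra.
Qed.

(** * From tilt stability to graph normals *)

(** The map [Q y = y + lam (m y - xbar)] reaches every point near 0. A graph point near [(xbar, 0)]
    thus has the same shift as some [(m y, y)], and strong monotonicity of the shifted graph
    identifies the two. *)
Lemma tilt_local_inverse {R : realType} {n} (phi : 'rV[R]_n -> \bar R)
    xbar kappa eps r :
  (forall y, phi y != -oo%E) -> 0 < eps -> 0 <= r ->
  local_prox phi xbar eps r -> tilt_stable phi xbar kappa ->
  exists m : 'rV[R]_n -> 'rV[R]_n, exists rho eta : R,
  [/\ 0 < rho, 0 < eta,
      forall y, enorm y <= rho -> limiting_subdiff phi (m y) y,
      forall y1 y2, enorm y1 <= rho -> enorm y2 <= rho ->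
        enorm (m y1 - m y2) <= kappa * enorm (y1 - y2) /\
        kappa^-1 * enorm (m y1 - m y2) ^+ 2 <= dot (y1 - y2) (m y1 - m y2) &
      forall x v, limiting_subdiff phi x v -> enorm (x - xbar) < eta ->
        enorm v < eta -> enorm v < rho /\ x = m v].
Proof.
move=> noo e0 r0 hp [dxb k0 [gam g0 [M0 [V [m [V0 hm mlip]]]]]].
have /nbhs_enormP[d d0 dV] := V0.
pose rho1 := Num.min (d / 2)
  (Num.min (gam / (2 * kappa)) (Num.min eps (eps / kappa))).
have rho10 : 0 < rho1 by rewrite !lt_min e0 !divr_gt0 ?mulr_gt0.
have hrho y : enorm y <= rho1 ->
    [/\ V y, kappa * enorm y < gam, enorm y <= eps & kappa * enorm y <= eps].
  rewrite !le_min => /and4P[y1]; rewrite !ler_pdivlMr ?mulr_gt0 // => y2 y3 y4.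
  by split=> //; [apply: dV; rewrite subr0; lra | lra | lra].
have z1 : enorm (0 : 'rV[R]_n) <= rho1 by rewrite enorm0 ltW.
have m0 : m 0 = xbar.
  have [V00 _ _ _] := hrho _ z1.
  have := hm _ V00; rewrite M0 => h.
  by have : [set m 0] (m 0) by []; rewrite -h.
have mx y : enorm y <= rho1 -> enorm (m y - xbar) <= kappa * enorm y.
  move=> yr; rewrite -m0 -{2}(subr0 y).
  by apply: mlip; [have [] := hrho _ yr | have [] := hrho _ z1].
have marg y : enorm y <= rho1 ->
    [/\ eball xbar gam (m y), dom phi (m y) & forall x, eball xbar gam x ->
      dom phi x -> fine (phi (m y)) - dot y (m y) <= fine (phi x) - dot y x].
  move=> yr; have [Vy _ _ _] := hrho _ yr.
  have : tilt_argmin phi xbar gam y (m y) by rewrite hm.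
  by move/tilt_argminP; apply=> //; exact: ltW.
have msub y : enorm y <= rho1 -> limiting_subdiff phi (m y) y.
  move=> yr; have [_ dm hmin] := marg _ yr; have [_ yg _ _] := hrho _ yr.
  rewrite -{2}[y]subr0 -(scale0r (m y - xbar)).
  apply: (@interior_argmin_subdiff _ _ _ _ gam) => //.
    exact: le_lt_trans (mx _ yr) yg.
  by move=> x xg dx; have := hmin x xg dx; rewrite !mul0r !sub0r.
pose rho := rho1 / 3.
have rho0 : 0 < rho by rewrite divr_gt0.
have rhole (y : 'rV[R]_n) : enorm y <= rho -> enorm y <= rho1.
  by rewrite /rho => ?; lra.
have lip y1 y2 : enorm y1 <= rho1 -> enorm y2 <= rho1 ->
    enorm (m y1 - m y2) <= kappa * enorm (y1 - y2).
  move=> y1r y2r; apply: mlip.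
    by have [] := hrho _ y1r.
  by have [] := hrho _ y2r.
have coco := @argmin_cocoercive _ _ (fun x => fine (phi x))
  [set x | eball xbar gam x /\ dom phi x] m kappa rho1 k0.
have {}coco y1 y2 : enorm y1 <= rho -> enorm y2 <= rho ->
    kappa^-1 * enorm (m y1 - m y2) ^+ 2 <= dot (y1 - y2) (m y1 - m y2).
  apply: coco => // u ur; have [mg dm hmin] := marg _ ur.
  by split=> // x [xg dx]; exact: hmin.
pose lam := r + 1; have lam0 : 0 < lam by rewrite ltr_wpDl.
(* This makes the target [c = v + lam (x - xbar)] have norm at most [rho / 4]. *)
pose eta := Num.min eps (rho / (4 * (1 + lam))).
have eta0 : 0 < eta by rewrite lt_min e0 divr_gt0 // mulr_gt0 // addr_gt0.
exists m, rho, eta; split=> //.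
- by move=> y /rhole; exact: msub.
- by move=> y1 y2 y1r y2r; split; [apply: lip; exact: rhole | exact: coco].
move=> x v hxv; rewrite !lt_min => /andP[xe].
rewrite ltr_pdivlMr => [xr /andP[ve]|]; last by rewrite mulr_gt0 // addr_gt0.
rewrite ltr_pdivlMr => [vr|]; last by rewrite mulr_gt0 // addr_gt0.
have vrho : enorm v < rho.
  by have := enorm_ge0 v; nra.
split=> //.
pose c := v + lam *: (x - xbar).
have cr : enorm c <= rho / 4.
  rewrite /c; apply: le_trans (enormD _ _) _; rewrite enormZ gtr0_norm //.
  have := enorm_ge0 v; have := enorm_ge0 (x - xbar).
  by rewrite ler_pdivlMr // => h1 h2; nra.
pose Q y := y + lam *: (m y - xbar).
have [||||| y [/= yr _ ymin]] := @min_eball _ _ (fun=> 0%E)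
    (fun y => enorm (Q y - c)) 0 rho (1 + lam * kappa).
- by move=> y a a0; exists setT => //; exact: filterT.
- by [].
- by exists 0; rewrite /eball /dom /= ?subrr ?enorm0 ?ltry // ltW.
- by rewrite addr_ge0 // mulr_ge0 // ltW.
- move=> y z; rewrite /eball /= !subr0 => yr zr.
  have := enorm_dist (Q z) (Q y) c.
  have -> : Q y - Q z = (y - z) + lam *: (m y - m z).
    rewrite /Q opprD addrACA; congr (_ + _).
    by rewrite -scalerBr opprB addrA subrK.
  have := enormD (y - z) (lam *: (m y - m z)); rewrite enormZ gtr0_norm //.
  have := ler_wpM2l (ltW lam0) (lip _ _ (rhole _ yr) (rhole _ zr)); lra.
rewrite /eball /= subr0 in yr.
have {}ymin z : enorm z <= rho -> enorm (Q y - c) <= enorm (Q z - c).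
  move=> zr; have := ymin z; rewrite /eball /dom /= subr0 ltry !add0r.
  by apply.
have zr : enorm (0 : 'rV[R]_n) <= rho by rewrite enorm0 ltW.
have Q0 : Q 0 = 0 by rewrite /Q m0 subrr scaler0 addr0.
have Qc : enorm (Q y - c) <= enorm c.
  by have := ymin _ zr; rewrite Q0 sub0r enormN.
(* Monotonicity of [m] gives [<y, Q y> >= |y|^2]. Hence the minimizer of the residual satisfies
   [|y| <= 2 |c| <= rho / 2], leaving room for a further step. *)
have yQ : enorm y <= enorm (Q y).
  apply: le_enormP; first exact: enorm_ge0.
  rewrite mulrC; apply: le_trans (cauchy_schwarz _ _).
  rewrite /Q [leRHS]dotDr lerDl dotZr mulr_ge0 ?(ltW lam0) //.
  have := coco _ _ yr zr; rewrite subr0 m0; apply: le_trans.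
  by rewrite mulr_ge0 ?sqr_ge0 // invr_ge0 ltW.
have yr2 : enorm y <= rho / 2.
  have := enormD (Q y - c) c; rewrite subrK; lra.
pose S := c - Q y; have SE : enorm S = enorm (Q y - c) by rewrite enormB.
have lk0 : 0 < 1 + lam * kappa by rewrite ltr_wpDr // ltW // mulr_gt0.
(* A nonzero residual [S] would shrink on moving [y] by [t S]. As [1 - t = t lam kappa],
   cocoercivity bounds [lam^2 |D|^2] by [(1 - t) lam <S, D>], so the new squared residual is at most
   [(1 - t)^2 |S|^2]. *)
have Qyc : Q y = c.
  apply/eqP; rewrite -subr_eq0 -enorm_eq0; apply/negPn/negP => S0.
  have {}S0 : 0 < enorm S by rewrite SE lt0r S0 enorm_ge0.
  pose t := (1 + lam * kappa)^-1.
  have t0 : 0 < t by rewrite invr_gt0.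
  have tE : t * (1 + lam * kappa) = 1 by rewrite mulVf // gt_eqF.
  have t1 : t <= 1.
    by have := mulr_gt0 t0 (mulr_gt0 lam0 k0); lra.
  have y'r : enorm (y + t *: S) <= rho.
    apply: le_trans (enormD _ _) _; rewrite enormZ gtr0_norm // SE.
    by have := enorm_ge0 (Q y - c); nra.
  have := ymin _ y'r; pose D := m (y + t *: S) - m y.
  have -> : Q (y + t *: S) - c = - ((1 - t) *: S - lam *: D).
    by rewrite /D /S /Q; apply/rowP => i; rewrite !mxE; ring.
  rewrite enormN -SE.
  have := coco _ _ y'r yr.
  have -> : y + t *: S - y = t *: S by rewrite addrAC subrr add0r.
  rewrite -/D dotZl => hD hS; clearbody D S t.
  have : enorm S ^+ 2 <= enorm ((1 - t) *: S - lam *: D) ^+ 2.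
    by rewrite ler_pXn2r ?nnegrE ?enorm_ge0.
  rewrite [X in _ <= X]enorm_sqr !dotE (dotC D S) -!enorm_sqr.
  have hD' : enorm D ^+ 2 <= kappa * (t * dot S D).
    by rewrite -ler_pdivrMl.
  have t1E : 1 - t = t * lam * kappa by lra.
  have SD0 : 0 <= t * dot S D.
    by apply: le_trans hD; rewrite mulr_ge0 ?sqr_ge0 // invr_ge0 ltW.
  have h1 := ler_wpM2l (sqr_ge0 lam) hD'.
  have h2 : 0 <= lam ^+ 2 * (kappa * (t * dot S D)).
    by rewrite mulr_ge0 ?sqr_ge0 // mulr_ge0 // ltW.
  have -> : (1 - t) * ((1 - t) * enorm S ^+ 2) = (1 - t) ^+ 2 * enorm S ^+ 2.
    by ring.
  have h3 : (1 - t) * (lam * dot S D) = lam ^+ 2 * (kappa * (t * dot S D)).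
    by rewrite t1E; ring.
  have h4 : 0 < t * (2 - t) * enorm S ^+ 2.
    by rewrite !mulr_gt0 ?exprn_gt0 // subr_gt0 (le_lt_trans t1) // ltr1n.
  lra.
have := local_prox_shift _ _ _ _ _ _ _ _ hp hxv (ltW xe) (ltW ve)
  (msub _ (rhole _ yr)).
have [_ _ ye ke] := hrho _ (rhole _ yr).
rewrite -/lam -/c -/(Q y) Qyc subrr enorm0.
move=> /(_ (le_trans (mx _ (rhole _ yr)) ke) ye) hle.
have xy : x = m y.
  by apply/eqP; rewrite -subr_eq0 -enorm_eq0 eq_le hle enorm_ge0.
by move: Qyc; rewrite /Q /c xy => /addIr <-.
Qed.

Lemma cocoercive_normal {R : realType} {n} (T : 'rV[R]_n -> set 'rV[R]_n)
    (m : 'rV[R]_n -> 'rV[R]_n) kappa y d0 z w : 0 < kappa -> 0 < d0 ->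
  (forall y', enorm (y' - y) <= d0 ->
     [/\ T (m y') y', enorm (m y' - m y) <= kappa * enorm (y' - y) &
         kappa^-1 * enorm (m y' - m y) ^+ 2 <= dot (y' - y) (m y' - m y)]) ->
  regular_normal_cone (gph T) (row_mx (m y) y) (row_mx z (- w)) ->
  kappa^-1 * enorm w ^+ 2 <= dot z w.
Proof.
move=> k0 d00 hm /regular_normal_coneP[_ hn].
apply/ler_addgt0Pr => e e0.
(* the direction [p = z - (2 / kappa) w] makes the estimate sharp *)
pose p := z - (2 / kappa) *: w.
(* The graph point over [y + t p] moves by at most [t K]; the added 1 covers [p = 0]. *)
pose K := (1 + kappa) * enorm p + 1.
have K0 : 0 < K by rewrite ltr_wpDl // mulr_ge0 ?enorm_ge0 // addr_ge0 // ltW.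
have [d dp hd] := hn (e / K) (divr_gt0 e0 K0).
pose t := Num.min d0 (d / 2) / K.
have t0 : 0 < t by rewrite divr_gt0 // lt_min d00 divr_gt0.
have tK : t * K = Num.min d0 (d / 2) by rewrite divfK // gt_eqF.
have tK1 : t * K <= d0 by rewrite tK ge_min lexx.
have tK2 : t * K <= d / 2 by rewrite tK ge_min lexx orbT.
have p0 := enorm_ge0 p.
have E : y + t *: p - y = t *: p by rewrite addrAC subrr add0r.
have Et : enorm (y + t *: p - y) = t * enorm p by rewrite E enormZ gtr0_norm.
have yd0 : enorm (y + t *: p - y) <= d0.
  rewrite Et; apply: le_trans tK1; rewrite ler_pM2l // /K; nra.
have [Tm ml mc] := hm _ yd0; rewrite Et E in ml mc.
set q := m _ - m y in ml mc.
have hdist : enorm (row_mx (m (y + t *: p)) (y + t *: p) - row_mx (m y) y) <=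
    t * K.
  rewrite row_mxB; apply: le_trans (enorm_row_mx_le _ _) _.
  rewrite Et -/q /K; lra.
have gm : gph T (row_mx (m (y + t *: p)) (y + t *: p)).
  by exists (m (y + t *: p), y + t *: p).
have near : enorm (row_mx (m (y + t *: p)) (y + t *: p) - row_mx (m y) y) < d.
  by apply: le_lt_trans hdist _; lra.
have := hd _ gm near.
rewrite {1}row_mxB dot_row_mx E -/q => h; clearbody q.
have {}h : dot z q - t * dot w p <= t * e.
  have -> : t * e = e / K * (t * K) by field; rewrite gt_eqF.
  rewrite -dotZr -dotNl.
  by apply: le_trans h _; rewrite ler_wpM2l // divr_ge0 ?ltW.
have zE : dot z q = dot p q + 2 / kappa * dot w q.
  by rewrite /p !dotE; ring.
have wE : dot w p = dot z w - 2 / kappa * enorm w ^+ 2.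
  by rewrite /p !dotE enorm_sqr (dotC w z); ring.
rewrite dotZl in mc.
(* Normality and cocoercivity give [|q|^2 / kappa + 2 t <w, q> / kappa <= t^2 (<w, p> + e)].
   Completing the square bounds the left side below by [- t^2 |w|^2 / kappa]. *)
have := dotxx_ge0 (q + t *: w).
rewrite !dotE (dotC q w) -!enorm_sqr => hq.
have k1 : 0 < kappa^-1 by rewrite invr_gt0.
have t2 : 0 < t ^+ 2 by rewrite exprn_gt0.
rewrite -(ler_pM2l t2).
have h1 := ler_wpM2l (ltW t0) h.
have h2 := ler_wpM2l (ltW k1) hq.
rewrite zE wE in h1; lra.
Qed.

(** * Limiting constructions and the pointbased criterion *)

Lemma gph_row_mx {R : realType} {n} (T : 'rV[R]_n -> set 'rV[R]_n) x y :
  gph T (row_mx x y) <-> T x y.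
Proof.
split=> [[[a b] /= Tab /eq_row_mx[<- <-]] //|Txy].
by exists (x, y).
Qed.

Lemma exists_small_inv {R : realType} (e : R) :
  0 < e -> exists k : nat, k.+1%:R^-1 < e.
Proof.
move=> e0; have [k hk] := filter_ex (near_infty_natSinv_lt (PosNum e0)).
by exists k.
Qed.

Lemma cvg_enorm_rate {R : realType} {n} (x_ : nat -> 'rV[R]_n) x C :
  (forall k, enorm (x_ k - x) <= C * k.+1%:R^-1) -> x_ @ \oo --> x.
Proof.
move=> h; apply/cvg_enormP => e e0.
have C0 : 0 < `|C| + 1 by rewrite ltr_wpDl.
have eC : 0 < e / (`|C| + 1) by rewrite divr_gt0.
apply: filterS (near_infty_natSinv_lt (PosNum eC)) => k /=.
rewrite ltr_pdivlMr // => hk; apply: le_lt_trans (h k) _.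
apply: le_lt_trans hk; rewrite mulrC ler_wpM2l ?invr_ge0 //.
by have := ler_norm C; lra.
Qed.

Lemma quadratic_bound_limit {R : realType} {n} c (z w : 'rV[R]_n) : 0 <= c ->
  (forall e, 0 < e -> exists z' w', [/\ enorm (z' - z) <= e,
     enorm (w' - w) <= e & c * enorm w' ^+ 2 <= dot z' w']) ->
  c * enorm w ^+ 2 <= dot z w.
Proof.
move=> c0 h; apply/ler_addgt0Pr => e e0.
have z0 := enorm_ge0 z; have w0 := enorm_ge0 w.
have cw : 0 <= c * enorm w by rewrite mulr_ge0.
(* [M] sums the coefficients of the four first-order errors below; the term [c |w' - w|^2] has the
   favorable sign. *)
pose M := enorm z + enorm w + 1 + 2 * (c * enorm w).
have M0 : 0 < M by rewrite /M; lra.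
pose t := Num.min 1 (e / M).
have t0 : 0 < t by rewrite lt_min ltr01 divr_gt0.
have t1 : t <= 1 by rewrite ge_min lexx.
have tM : t * M <= e by rewrite -ler_pdivlMr // ge_min lexx orbT.
have [z' [w' [zt wt hb]]] := h t t0.
have -> : c * enorm w ^+ 2 = c * enorm w' ^+ 2 - c * enorm (w' - w) ^+ 2
    + 2 * c * dot w (w - w').
  by rewrite !enorm_sqr !dotE (dotC w' w); ring.
have zwE : dot z w = dot z' w' - dot (z' - z) w - dot (z' - z) (w' - w) -
    dot z (w' - w).
  by rewrite !dotE; ring.
have h1 := cauchy_schwarz (z' - z) w.
have h2 := cauchy_schwarz (z' - z) (w' - w).
have h3 := cauchy_schwarz z (w' - w).
have h4 := cauchy_schwarz w (w - w').
have n0 := enorm_ge0 (z' - z); have n1 := enorm_ge0 (w' - w).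
have h4' : 2 * c * dot w (w - w') <= t * (2 * (c * enorm w)).
  apply: le_trans (ler_wpM2l _ h4) _; first by rewrite mulr_ge0.
  rewrite (enormB w); nra.
have h5 : 0 <= c * enorm (w' - w) ^+ 2 by rewrite mulr_ge0 // sqr_ge0.
have h1' : enorm (z' - z) * enorm w <= t * enorm w by rewrite ler_wpM2r.
have h2' : enorm (z' - z) * enorm (w' - w) <= t.
  by rewrite -[leRHS]mulr1; apply: ler_pM => //; exact: le_trans wt t1.
have h3' : enorm z * enorm (w' - w) <= t * enorm z.
  by rewrite [leRHS]mulrC ler_wpM2l.
rewrite zwE; rewrite /M in tM; lra.
Qed.

(** A limiting normal is a limit of regular normals at graph points which eventually lie in the open
    balls inside [U] and [V]; the bound passes to the limit with the same [kappa]. *)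
Lemma combined_limiting_bound {R : realType} {n} (phi : 'rV[R]_n -> \bar R)
    (xbar : 'rV[R]_n) kappa (U V : set 'rV[R]_n) :
  0 < kappa -> nbhs xbar U -> nbhs (0 : 'rV[R]_n) V ->
  (forall x y w z, limiting_subdiff phi x y -> U x -> V y ->
     combined_subdiff2 phi x y w z -> kappa^-1 * enorm w ^+ 2 <= dot z w) ->
  exists U' V' : set 'rV[R]_n, [/\ nbhs xbar U', nbhs (0 : 'rV[R]_n) V' &
    forall x y w z, limiting_subdiff phi x y -> U' x -> V' y ->
      limiting_subdiff2 phi x y w z -> kappa^-1 * enorm w ^+ 2 <= dot z w].
Proof.
move=> k0 /nbhs_enormP[d1 d10 hU] /nbhs_enormP[d2 d20 hV] h.
exists [set x | enorm (x - xbar) < d1], [set y | enorm (y - 0) < d2]; split.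
- by apply/nbhs_enormP; exists d1.
- by apply/nbhs_enormP; exists d2.
move=> x y w z hxy /= xd yd.
move=> /limiting_normal_coneP[_ [X_ [N_ [/cvg_enormP cX /cvg_enormP cN hN]]]].
apply: quadratic_bound_limit; first by rewrite invr_ge0 ltW.
move=> e e0.
pose e1 := Num.min (d1 - enorm (x - xbar)) (d2 - enorm (y - 0)).
have e10 : 0 < e1 by rewrite lt_min !subr_gt0 xd.
have [k [Xk Nk]] : exists k, enorm (X_ k - row_mx x y) < e1 /\
    enorm (N_ k - row_mx z (- w)) < e.
  exact: filter_ex (filterI (cX _ e10) (cN _ e0)).
have := hN k; have /regular_normal_coneP[gX _] := hN k.
case: gX => -[a b] /= Tab XE; move: Xk Nk; rewrite -XE.
rewrite -(hsubmxK (N_ k)); set p := lsubmx _; set q := rsubmx _.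
rewrite !row_mxB => Xk Nk hn.
have [ax by_] := enorm_row_mx_ge (a - x) (b - y).
have [pz qw] := enorm_row_mx_ge (p - z) (q - - w).
exists p, (- q); split.
- exact: ltW (le_lt_trans pz Nk).
- by rewrite -opprD enormN -[w]opprK; exact: ltW (le_lt_trans qw Nk).
move: Xk; rewrite lt_min !ltrBrDr => /andP[Xk1 Xk2].
apply: (h a b) => //.
- by apply: hU; apply: le_lt_trans (enorm_dist x a xbar) _; lra.
- by apply: hV; apply: le_lt_trans (enorm_dist y b 0) _; lra.
- by rewrite /combined_subdiff2 /= opprK.
Qed.

(** For the normal [(lam s - q, s)] with [|q| = 1], the bound with [w = - s] reads
    [(lam + 1 / kappa) |s|^2 <= <q, s> <= |s|]. The resulting [l = 1 / (lam + 1 / kappa)] returns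
    exactly the modulus [kappa]. *)
Lemma tilt_of_combined_bound {R : realType} {n} (phi : 'rV[R]_n -> \bar R)
    (xbar : 'rV[R]_n) eps lam rho P kappa (U V : set 'rV[R]_n) :
  (forall y, phi y != -oo%E) -> lower_semicontinuous phi -> dom phi xbar ->
  resolvent phi xbar eps lam rho P -> 1 <= lam -> 0 < kappa ->
  nbhs xbar U -> nbhs (0 : 'rV[R]_n) V ->
  (forall x y w z, limiting_subdiff phi x y -> U x -> V y ->
     combined_subdiff2 phi x y w z -> kappa^-1 * enorm w ^+ 2 <= dot z w) ->
  tilt_stable phi xbar kappa.
Proof.
move=> noo lsc dxb res lam1 k0.
move=> /nbhs_enormP[d1 d10 hU] /nbhs_enormP[d2 d20 hV] h.
have ki : 0 < kappa^-1 by rewrite invr_gt0.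
have lk0 : 0 < lam + kappa^-1 by lra.
have lam2 : 0 < 1 + 2 * lam by lra.
pose sg := Num.min rho (Num.min (d1 / 2) (d2 / (1 + 2 * lam))).
have rho0 := res_rho _ _ _ _ _ _ res.
suff : tilt_stable phi xbar (((lam + kappa^-1)^-1)^-1 - lam)^-1.
  by rewrite invrK addrC addKr invrK.
apply: (tilt_of_normals _ _ _ _ _ _ sg _ noo lsc dxb res) => //.
- by rewrite !lt_min rho0 !divr_gt0.
- by rewrite ge_min lexx.
- by rewrite invr_gt0.
- by rewrite ltr_pdivrMr // mul1r ltrDl.
move=> u q s; rewrite !lt_min => /and3P[ur]; rewrite !ltr_pdivlMr // => u1 u2.
move=> q1 s1 hn.
have nu := res_near _ _ _ _ _ _ res _ (ltW ur).
have := h (P u) (u - lam *: (P u - xbar)) (- s) (lam *: s - q)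
  (res_subdiff _ _ _ _ _ _ res _ (ltW ur)).
rewrite /combined_subdiff2 /= opprK => /(_ _ _ hn).
have UP : U (P u) by apply: hU; apply: le_lt_trans nu _; lra.
have VP : V (u - lam *: (P u - xbar)).
  apply: hV; rewrite subr0; apply: le_lt_trans (enormD _ _) _.
  rewrite enormN enormZ ger0_norm; last by lra.
  have lam0 : 0 <= lam by lra.
  by have := ler_wpM2l lam0 nu; lra.
move=> /(_ UP VP).
rewrite enormN !dotE -enorm_sqr => hb.
have := cauchy_schwarz q s; rewrite q1 mul1r => hq.
rewrite -div1r ler_pdivlMr //.
have [->|s0] := eqVneq s 0; first by rewrite enorm0 mul0r.
rewrite -enorm_gt0 in s0.
rewrite -(ler_pM2r s0) mul1r; lra.
Qed.

Lemma tilt_of_positive_definite {R : realType} {n} (phi : 'rV[R]_n -> \bar R)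
    xbar eps lam rho P :
  (forall y, phi y != -oo%E) -> lower_semicontinuous phi ->
  limiting_subdiff phi xbar 0 ->
  resolvent phi xbar eps lam rho P -> 1 <= lam ->
  (forall w z, w != 0 -> limiting_subdiff2 phi xbar 0 w z -> 0 < dot z w) ->
  exists kappa, 0 < kappa /\ tilt_stable phi xbar kappa.
Proof.
move=> noo lsc h0 res lam1 pd.
have dxb : dom phi xbar by case: h0.
have rho0 := res_rho _ _ _ _ _ _ res.
have lam0 : 0 < lam by lra.
have li0 : 0 < lam^-1 by rewrite invr_gt0.
have li1 : lam^-1 <= 1 by rewrite invf_le1.
(* These candidate constants increase to [1 / lam]; the shift by two makes [l 0] positive. If
   [good k] is empty, [l k] is a valid Lipschitz constant. *)
pose l (k : nat) := lam^-1 * (1 - k.+2%:R^-1).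
have k2 (k : nat) : 0 < (k.+2%:R : R)^-1 /\ (k.+2%:R : R)^-1 < 1.
  by rewrite invr_gt0 ltr0n invf_lt1 ?ltr0n // ltr1n.
pose good k (t : 'rV[R]_n * 'rV[R]_n * 'rV[R]_n) :=
  let: (u, q, s) := t in
  [/\ enorm u < rho / k.+1%:R, enorm q = 1, enorm s <= 1,
      regular_normal_cone (gph (limiting_subdiff phi))
       (row_mx (P u) (u - lam *: (P u - xbar))) (row_mx (lam *: s - q) s) &
      l k < enorm s].
have [[k hk]|hk] := pselect (exists k, forall t, ~ good k t).
  have [k20 k21] := k2 k.
  have lk0 : 0 < l k by rewrite mulr_gt0 // subr_gt0.
  have llk : lam * l k < 1.
    by rewrite /l mulrA divff ?gt_eqF // mul1r; lra.
  exists ((l k)^-1 - lam)^-1; split.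
    by rewrite invr_gt0 subr_gt0 -div1r ltr_pdivlMr.
  apply: (tilt_of_normals _ _ _ _ _ _ (rho / k.+1%:R) _ noo lsc dxb res) => //.
  - by rewrite divr_gt0 // ltr0n.
  - by rewrite ler_pdivrMr ?ltr0n // ler_peMr ?ler1n // ltW.
  move=> u q s ur q1 s1 hn; rewrite leNgt; apply/negP => ls.
  by apply: (hk (u, q, s)).
have {}hk k : exists t, good k t.
  by apply: contrapT => hne; apply: hk; exists k => t gt; apply: hne; exists t.
have goodS j k t : (j <= k)%N -> good k t -> good j t.
  move=> jk; case: t => [[u q] s] [ur q1 s1 hn ls]; split=> //.
    apply: lt_le_trans ur _; rewrite ler_wpM2l ?(ltW rho0) //.
    by rewrite lef_pV2 ?posrE ?ltr0n // ler_nat.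
  apply: le_lt_trans ls; rewrite ler_wpM2l ?(ltW li0) // lerB //.
  by rewrite lef_pV2 ?posrE ?ltr0n // ler_nat.
(* Only [(q, s)] needs a cluster point, since [u] tends to 0 by construction. *)
pose S k := [set row_mx t.1.2 t.2 | t in good k].
have [||| X hX] := @nested_cluster _ _ S 2.
- by move=> k; have [t gt] := hk k; exists (row_mx t.1.2 t.2), t.
- by move=> j k jk _ [t gt <-]; exists t => //; exact: goodS gt.
- move=> _ [[[u q] s] [_ q1 s1 _ _] <-] /=.
  by apply: le_trans (enorm_row_mx_le _ _) _; rewrite q1; lra.
pose q := lsubmx X; pose s := rsubmx X.
have XE : X = row_mx q s by rewrite hsubmxK.
(* Choosing the k-th triple from the k-th nested set at distance below [1 / (k + 1)] avoids
   extracting subsequences. *)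
have ht k : exists t, [/\ good k t, enorm (t.1.2 - q) < k.+1%:R^-1 &
    enorm (t.2 - s) < k.+1%:R^-1].
  have k10 : 0 < (k.+1%:R : R)^-1 by rewrite invr_gt0 ltr0n.
  have [_ [t gt <-]] := hX k _ k10; rewrite XE row_mxB => ht.
  have [h1 h2] := enorm_row_mx_ge (t.1.2 - q) (t.2 - s).
  by exists t; split=> //; [exact: le_lt_trans ht|exact: le_lt_trans ht].
have [t_ {}ht] := choice ht.
have q1 : enorm q <= 1.
  apply/ler_addgt0Pr => e /exists_small_inv[k ke].
  have [] := ht k; case: (t_ k) => [[uk qk] sk] [_ qk1 _ _ _] /= hq _.
  have := enormD (q - qk) qk; rewrite subrK (enormB q) qk1.
  have := lt_trans hq ke; lra.
have s1 : lam^-1 <= enorm s.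
  apply/ler_addgt0Pr => e e0.
  have e20 : 0 < e / 2 by rewrite divr_gt0.
  have [k ke] := exists_small_inv _ e20.
  have [] := ht k; case: (t_ k) => [[uk qk] sk] [_ _ _ _ lsk] /= _ hs.
  have := enormD (sk - s) s; rewrite subrK.
  have kk : (k.+2%:R : R)^-1 <= k.+1%:R^-1.
    by rewrite lef_pV2 ?posrE ?ltr0n // ler_nat.
  have [k20 _] := k2 k.
  have : lam^-1 * k.+2%:R^-1 <= k.+2%:R^-1 by rewrite ler_piMl // ltW.
  move: lsk hs kk ke; rewrite /l mulrBr mulr1.
  move: (k.+1%:R^-1) (k.+2%:R^-1) => a b; lra.
have s0 : - s != 0 by rewrite oppr_eq0 -enorm_gt0 (lt_le_trans li0).
have := pd (- s) (lam *: s - q) s0.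
rewrite /limiting_subdiff2 /= opprK.
(* For this limit, [<lam s - q, - s> <= |s| (1 - lam |s|) <= 0] with [s != 0], contrary to positive
   definiteness. *)
suff hl : limiting_normal_cone (gph (limiting_subdiff phi))
    (row_mx xbar 0) (row_mx (lam *: s - q) s).
  move=> /(_ hl); have := cauchy_schwarz q s; have := enorm_ge0 s.
  rewrite !dotE -enorm_sqr => n0 hc hpos; exfalso.
  have h1 : enorm q * enorm s <= enorm s by rewrite ler_piMl.
  have h2 : 1 <= lam * enorm s by rewrite -ler_pdivrMl // mulr1.
  have h3 : enorm s <= lam * enorm s ^+ 2.
    by rewrite expr2 mulrA ler_peMl.
  lra.
apply/limiting_normal_coneP; split; first exact/gph_row_mx.
exists (fun k => let u := (t_ k).1.1 in
  row_mx (P u) (u - lam *: (P u - xbar))).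
exists (fun k => row_mx (lam *: (t_ k).2 - (t_ k).1.2) (t_ k).2).
split.
- apply: (@cvg_enorm_rate _ _ _ _ ((3 + 2 * lam) * rho)) => k /=.
  have [] := ht k; case: (t_ k) => [[uk qk] sk] [ur _ _ _ _] _ _ /=.
  have ur' : enorm uk <= rho.
    apply: ltW; apply: lt_le_trans ur _.
    by rewrite ler_pdivrMr ?ltr0n // ler_peMr ?ler1n // ltW.
  have nu := res_near _ _ _ _ _ _ res _ ur'.
  rewrite row_mxB; apply: le_trans (enorm_row_mx_le _ _) _; rewrite subr0.
  have := enormD uk (- (lam *: (P uk - xbar))).
  rewrite enormN enormZ gtr0_norm // => h1.
  have := ler_wpM2l (ltW lam0) nu; have := ltW ur.
  rewrite -mulrA; set c := rho / _ => h2 h3.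
  have l3 : 0 <= 3 + 2 * lam by lra.
  have := ler_wpM2l l3 h2; lra.
- apply: (@cvg_enorm_rate _ _ _ _ (lam + 2)) => k.
  have [_] := ht k; case: (t_ k) => [[uk qk] sk] /= /ltW hq /ltW hs.
  rewrite row_mxB; apply: le_trans (enorm_row_mx_le _ _) _.
  have -> : lam *: sk - qk - (lam *: s - q) = lam *: (sk - s) - (qk - q).
    by apply/rowP => i; rewrite !mxE; ring.
  have := enormD (lam *: (sk - s)) (- (qk - q)).
  rewrite enormN enormZ gtr0_norm // => h1.
  have h2 := ler_wpM2l (ltW lam0) hs.
  move: hq hs h2; move: (k.+1%:R^-1) => a; lra.
- move=> k; have [] := ht k; case: (t_ k) => [[uk qk] sk] [_ _ _ hn _] _ _.
  exact: hn.
Qed.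

(** Graph points near [(xbar, 0)] have the form [(m y, y)] with [|y| < rho], so cocoercivity of [m]
    is available on a ball of radius [rho - |y|] around [y]. *)
Lemma combined_bound_of_tilt {R : realType} {n} (phi : 'rV[R]_n -> \bar R)
    (xbar : 'rV[R]_n) kappa eps r :
  (forall y, phi y != -oo%E) -> 0 < eps -> 0 <= r ->
  local_prox phi xbar eps r -> tilt_stable phi xbar kappa ->
  exists U V : set 'rV[R]_n, [/\ nbhs xbar U, nbhs (0 : 'rV[R]_n) V &
    forall x y w z, limiting_subdiff phi x y -> U x -> V y ->
      combined_subdiff2 phi x y w z -> kappa^-1 * enorm w ^+ 2 <= dot z w].
Proof.
move=> noo e0 r0 hp ht; have [_ k0 _] := ht.
have [m [rho [eta [rho0 eta0 msub mlip minv]]]] :=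
  tilt_local_inverse _ _ _ _ _ noo e0 r0 hp ht.
exists [set x | enorm (x - xbar) < eta], [set y | enorm (y - 0) < eta]; split.
- by apply/nbhs_enormP; exists eta.
- by apply/nbhs_enormP; exists eta.
move=> x y w z hxy /= xe; rewrite subr0 => ye.
have [yr ->] := minv _ _ hxy xe ye.
apply: (@cocoercive_normal _ _ _ m _ _ (rho - enorm y)) => //.
  by rewrite subr_gt0.
move=> y' y'y; have y'r : enorm y' <= rho.
  by rewrite -(subrK y y'); apply: le_trans (enormD _ _) _; lra.
by have [] := mlip _ _ y'r (ltW yr); split=> //; exact: msub.
Qed.

Theorem corollary5p7 (R : realType) (n : nat) (phi : 'rV[R]_n -> \bar R)
    (xbar : 'rV[R]_n) (kappa : R)
    (hproper : proper_fun phi) (hdom : dom phi xbar)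
    (hsub : limiting_subdiff phi xbar 0)
    (hprox : continuously_prox_regular phi xbar 0)
    (hkappa : 0 < kappa) :
  [/\ tilt_stable phi xbar kappa <->
      (exists U V : set 'rV[R]_n,
         [/\ nbhs xbar U, nbhs (0 : 'rV[R]_n) V &
             forall x y w z : 'rV[R]_n,
               limiting_subdiff phi x y -> U x -> V y ->
               combined_subdiff2 phi x y w z ->
               kappa^-1 * enorm w ^+ 2 <= dot z w]),
      tilt_stable phi xbar kappa <->
      (exists U V : set 'rV[R]_n,
         [/\ nbhs xbar U, nbhs (0 : 'rV[R]_n) V &
             forall x y w z : 'rV[R]_n,
               limiting_subdiff phi x y -> U x -> V y ->
               limiting_subdiff2 phi x y w z ->
               kappa^-1 * enorm w ^+ 2 <= dot z w]) &
      (exists kappa' : R, 0 < kappa' /\ tilt_stable phi xbar kappa') <->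
      (forall w z : 'rV[R]_n,
         w != 0 -> limiting_subdiff2 phi xbar 0 w z -> 0 < dot z w)].
Proof.
have [noo _] := hproper.
have [lsc _ _] := hprox.1.
have [eps [r [e0 r0 hp]]] := prox_regular_local _ _ noo hdom hprox.
have [rho [P res]] := resolvent_exists _ _ _ _ noo lsc hsub e0 r0 hp.
have lam1 : 1 <= r + 1 by rewrite lerDr.
have limiting_bound k : tilt_stable phi xbar k ->
    exists U V : set 'rV[R]_n, [/\ nbhs xbar U, nbhs (0 : 'rV[R]_n) V &
      forall x y w z, limiting_subdiff phi x y -> U x -> V y ->
        limiting_subdiff2 phi x y w z -> k^-1 * enorm w ^+ 2 <= dot z w].
  move=> ht; have [_ k0 _] := ht.
  have [U [V [xU V0 h]]] := combined_bound_of_tilt _ _ _ _ _ noo e0 r0 hp ht.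
  exact: combined_limiting_bound xU V0 h.
split; split.
- exact: combined_bound_of_tilt hp.
- move=> [U [V [xU V0 h]]].
  exact: (tilt_of_combined_bound _ _ _ _ _ _ _ _ _ noo lsc hdom res lam1 hkappa
    xU V0 h).
- exact: limiting_bound.
- move=> [U [V [xU V0 h]]].
  apply: (tilt_of_combined_bound _ _ _ _ _ _ _ _ _ noo lsc hdom res lam1 hkappa
    xU V0) => x y w z hxy Ux Vy hz.
  (* Regular normals are limiting normals, so (iii) contains (ii). *)
  by apply: (h x y) => //; exact: limiting_of_regular.
- move=> [k [k0 /limiting_bound[U [V [xU V0 h]]]]] w z w0 hz.
  (* The neighborhood bound is evaluated at the base point [(xbar, 0)] itself. *)
  have := h _ _ _ _ hsub (nbhs_singleton xU) (nbhs_singleton V0) hz.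
  by apply: lt_le_trans; rewrite mulr_gt0 ?invr_gt0 ?exprn_gt0 ?enorm_gt0.
- exact: (tilt_of_positive_definite _ _ _ _ _ _ noo lsc hsub res lam1).
Qed.
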